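(* Let $(\mu,\chi,u)$, with $\mu=(\mu_t)_{t\in(0,T_* )}$, be a varifold solution on $(0,T_* )$ of the regularized visco-elastic Mullins–Sekerka system with initial data $(\chi_0,u_0)$ (in the sense defined in the context). Then there exists a function $\theta:(0,T_* )\times\Omega\to[0,\infty)$ with $|\theta|\le1$ almost everywhere (i.e. for almost all $t$, $|\theta(t,x)|\le 1$ for $|\mu_t^\Omega|$-a.e. $x\in\Omega$) such that for almost all $t\in(0,T_* )$ $$\int_{\mathbb{S}^{d-1}}s\,d\mu^\Omega_{t,x}(s)=\begin{cases}\theta(t,x)\,\nu(t,x)&\text{for }|\mu_t^\Omega|\text{-a.e. }x\in\partial^*\mathcal{A}(t),\\0&\text{for }|\mu_t^\Omega|\text{-a.e. }x\in\Omega\setminus\partial^*\mathcal{A}(t),\end{cases}$$ where $\chi(t)=\chi_{\mathcal{A}(t)}$ is the characteristic function of the set $\mathcal{A}(t)$ of finite perimeter in $\Omega$, $\partial^*\mathcal{A}(t)\subset\Omega$ is its reduced boundary in $\Omega$, and $\nu(t,x)=\frac{\nabla\chi(t,x)}{|\nabla\chi(t,x)|}$ is the interior normal of $\partial^*\mathcal{A}(t)$. Moreover, if $|\mu_t^\Omega|(\Omega)=|\nabla\chi(t)|(\Omega)$, then $\mu^\Omega_{t,x}=\delta_{\nu(t,x)}$ for $|\mu^\Omega_t|$-a.e. $x\in\Omega$.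
   Context: Setting. $\Omega\subset\mathbb{R}^d$, $d\in\{2,3\}$, is a bounded smooth domain, $n_{\partial\Omega}$ its inner unit normal on $\partial\Omega$; $T_*>0$, $c_0>0$, $\alpha\in(0,\tfrac\pi2]$ are fixed; $\chi_0\in BV(\Omega;\{0,1\})$ with $0<\int_\Omega\chi_0\,dx<|\Omega|$, $u_0\in H^1_\perp(\Omega)\cap H^2(\Omega;\mathbb{R}^d)$. Conventions: $(\nabla u)_{ij}=\partial_ju_i$, $(\nabla^2u)_{ijk}=\partial_j\partial_ku_i$, $(\nabla^2u\,B)_{ij}=(\nabla^2u)_{ijk}B_k$; repeated indices are summed; '':'' is full contraction; $\mathcal{E}(u)=\tfrac12(\nabla u+(\nabla u)^T)$. Elastic data: for $y\in\mathbb{R}$, $\mathbb{C}(y),\mathbb{C}_\nu(y)$ are symmetric linear endomorphisms of $\mathbb{R}^{d\times d}_{sym}$, uniformly positive ($\mathbb{C}(y)E':E'\ge c|E'|^2$, likewise $\mathbb{C}_\nu$, with $c>0$ independent of $y$); $\mathcal{T}(y)\in\mathbb{R}^{d\times d}_{sym}$; $W(\chi,E')=\tfrac12\mathbb{C}(\chi)(E'-\mathcal{T}(\chi)):(E'-\mathcal{T}(\chi))$, $W_{,\mathcal{E}}(\chi,E')=\mathbb{C}(\chi)(E'-\mathcal{T}(\chi))$. Spaces: $H^1_\perp(\Omega)$ is the $H^1$-orthogonal complement of $\{u\in H^1(\Omega;\mathbb{R}^d):\mathcal{E}(u)=0\}$; $H^1_{(0)}(\Omega)$ are the mean-zero $H^1$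 functions, $H^{-1}_{(0)}(\Omega)$ its dual with norm $\|f\|_{H^{-1}_{(0)}}=\|\nabla(-\Delta_N)^{-1}f\|_{L^2}$, where $\langle-\Delta_Nv,\xi\rangle=\int\nabla v\cdot\nabla\xi$; $\|z\|_{H^1_\chi}^2=\int_\Omega\mathbb{C}_\nu(\chi)\mathcal{E}(z):\mathcal{E}(z)\,dx$; $L^\infty_{w^*}$ means essentially bounded and weak-* measurable. $M(X)$: finite Radon measures; an oriented varifold on $\overline\Omega$ is a positive $V\in M(\overline\Omega\times\mathbb{S}^{d-1})$ with mass measure $|V|(U)=V(U\times\mathbb{S}^{d-1})$; measures on $\partial\Omega\times\mathbb{S}^{d-1}$ are extended by zero; $\sigma\otimes(\omega_x)$ is the measure $f\mapsto\iint f(x,s)\,d\omega_x(s)\,d\sigma(x)$. Varifold solution: a measurable $\chi:(0,T_* )\times\Omega\to\{0,1\}$, a family $(\mu_t)_{t\in(0,T_* )}$ of oriented varifolds on $\overline\Omega$, and $u:(0,T_* )\times\Omega\to\mathbb{R}^d$ such that: (1) $\chi\in L^\infty_{w^*}(0,T_*;BV(\Omega;\{0,1\}))\cap H^1(0,T_*;H^{-1}_{(0)}(\Omega))$, $u\in H^1(0,T_*;H^1_\perp(\Omega))\cap L^\infty(0,T_*;H^2(\Omega;\mathbb{R}^d))$. (2) $\chi(0)=\chi_0$ in $H^{-1}_{(0)}(\Omega)$, $u(0)=u_0$ in $H^1_\perp(\Omega)$. (3) For a.e. $t$: $\mu_t=c_0\mu_t^\Omega+c_0(\cos\alpha)\mu_t^{\partial\Omega}$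 with $\mu_t^\Omega=|\mu_t^\Omega|\otimes(\mu^\Omega_{t,x})_{x\in\overline\Omega}\in M(\overline\Omega\times\mathbb{S}^{d-1})$, $\mu_t^{\partial\Omega}=|\mu_t^{\partial\Omega}|\otimes(\delta_{n_{\partial\Omega}(x)})_{x\in\partial\Omega}\in M(\partial\Omega\times\mathbb{S}^{d-1})$ oriented varifolds, $\mu^\Omega_{t,x}$ probability measures on $\mathbb{S}^{d-1}$ for $|\mu_t^\Omega|$-a.e. $x$, and $|\mu_t^{\partial\Omega}|=g(t,\cdot)\mathcal{H}^{d-1}\llcorner\partial\Omega$ with $g\in L^\infty((0,T_* )\times\partial\Omega;[0,1])$. (4) For a.e. $t$: $\int_{\overline\Omega\times\mathbb{S}^{d-1}}\eta\cdot s\,d\mu_t^\Omega=\int_\Omega\eta\cdot d\nabla\chi(t)$ for all $\eta\in C^1(\overline\Omega;\mathbb{R}^d)$ with $\eta\cdot n_{\partial\Omega}=0$ on $\partial\Omega$; $-\int s\cdot\xi\,d\mu_t^\Omega=-\int_\Omega\xi\cdot d\nabla\chi(t)+(\cos\alpha)(|\mu_t^{\partial\Omega}|(\partial\Omega)-\int_{\partial\Omega}\chi(t)\,d\mathcal{H}^{d-1})$ for all $\xi\in C^1(\overline\Omega;\mathbb{R}^d)$ with $\xi\cdot n_{\partial\Omega}=\cos\alpha$ on $\partial\Omega$; and $(\cos\alpha)\chi(t)\mathcal{H}^{d-1}\llcorner\partial\Omega\le\cos\alpha(|\mu_t^\Omega|\llcorner\partial\Omega+|\mu_t^{\partial\Omega}|)$.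 (5) There is $w\in L^2(0,T_*;H^1(\Omega))$ such that for a.e. $t$ and all $B\in C^2(\overline\Omega;\mathbb{R}^d)$ with $B\cdot n_{\partial\Omega}=0$ on $\partial\Omega$: $\int_{\overline\Omega\times\mathbb{S}^{d-1}}(I-s\otimes s):\nabla B\,d\mu_t=\int_\Omega\chi\,\mathrm{div}(wB)+\int_\Omega\mathbb{C}_\nu(\chi)\mathcal{E}(\partial_tu):\nabla^2u\,B-\int_\Omega\tfrac12|\nabla^2u|^2\mathrm{div}B-\int_\Omega[W(\chi,\mathcal{E}(u))I-(\nabla u)^T(\mathbb{C}_\nu(\chi)\mathcal{E}(\partial_tu)+W_{,\mathcal{E}}(\chi,\mathcal{E}(u)))]:\nabla B+\int_\Omega(\nabla^2u)_{ijk}(\nabla u)_{ip}(\nabla^2B)_{pjk}+\int_\Omega(\nabla^2u)_{ijk}((\nabla^2u)_{ipk}(\nabla B)_{jp}+(\nabla^2u)_{ijp}(\nabla B)_{kp})$. (6) $v=-(-\Delta_N)^{-1}\partial_t\chi\in L^2(0,T_*;H^1_{(0)}(\Omega))$ satisfies $\int_0^{T_*}\int_\Omega\chi\,\partial_t\zeta-\int_0^{T_*}\int_\Omega\nabla v\cdot\nabla\zeta=-\int_\Omega\chi_0\zeta(0)$ for all $\zeta\in C^1_c([0,T_* )\times\Omega)\cap H^1(0,T_*;H^1_{(0)}(\Omega))$, and $\int_\Omega\chi(t)=\int_\Omega\chi_0$ for a.e. $t$. (7) $\int_0^{T_*}\int_\Omega[\mathbb{C}_\nu(\chi)\mathcal{E}(\partial_tu)+W_{,\mathcal{E}}(\chi,\mathcal{E}(u))]:\mathcal{E}(z)+\nabla^2u:\nabla^2z\,dx\,dt=0$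 for all $z\in L^2(0,T_*;H^2(\Omega;\mathbb{R}^d))$. (8) For a.e. $0\le s\le T\le T_*$: $\mathcal{F}(\mu,\chi,u)(T)+\frac12\int_s^T\|\partial_t\chi\|^2_{H^{-1}_{(0)}}+\|\partial_tu\|^2_{H^1_{\chi(t)}}dt+\frac12\int_s^T\|\nabla w\|_{L^2}^2+\|\partial_tu\|^2_{H^1_{\chi(t)}}dt\le\mathcal{F}(\mu,\chi,u)(s)\le\mathcal{F}(\chi_0,u_0)$, where $\mathcal{F}(\mu,\chi,u)(t)=|\mu_t|(\overline\Omega)+\int_\Omega W(\chi,\mathcal{E}(u))(t)+\int_\Omega\tfrac12|\nabla^2u|^2(t)$ and $\mathcal{F}(\chi_0,u_0)=c_0|\nabla\chi_0|(\Omega)+\int_{\partial\Omega}c_0(\cos\alpha)\chi_0\,d\mathcal{H}^{d-1}+\int_\Omega W(\chi_0,\mathcal{E}(u_0))+\int_\Omega\tfrac12|\nabla^2u_0|^2$. (9) $t\mapsto|\mu_t|(\overline\Omega)$ is measurable. *)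

(* Defs.v *)
From HB Require Import structures.
From mathcomp Require Import all_boot all_order all_algebra.
From mathcomp Require Import all_classical all_reals all_analysis measurable_realfun.

Set Implicit Arguments.
Unset Strict Implicit.
Unset Printing Implicit Defensive.
Import Order.TTheory GRing.Theory Num.Theory.
Import numFieldNormedType.Exports.
Local Open Scope classical_set_scope.
Local Open Scope ring_scope.

(** * Borel sigma-algebra and Lebesgue measure on [R^n = 'rV[R]_n] *)

Section borel_rV.
Context {R : realType} (n : nat).

Let coors : 'I_n -> 'rV[R]_n -> R := fun i x => x 0 i.

Let rV_set0 : g_sigma_preimage coors set0.
Proof. exact: sigma_algebra0. Qed.

Let rV_setC A : g_sigma_preimage coors A -> g_sigma_preimage coors (~` A).
Proof. exact: sigma_algebraC. Qed.

Let rV_bigcup (F : _^nat) : (forall i, g_sigma_preimage coors (F i)) ->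
  g_sigma_preimage coors (\bigcup_i (F i)).
Proof. exact: sigma_algebra_bigcup. Qed.

HB.instance Definition _ := @isMeasurable.Build default_measure_display
  'rV[R]_n (g_sigma_preimage coors) rV_set0 rV_setC rV_bigcup.

End borel_rV.

Section borel_rV_theory.
Context {R : realType}.

Lemma measurable_coord n (i : 'I_n) :
  measurable_fun [set: 'rV[R]_n] (fun x : 'rV[R]_n => x 0 i).
Proof.
move=> _ Y mY; rewrite setTI; apply: sub_sigma_algebra => /=.
rewrite -bigcup_seq/=; exists i => /=; first by rewrite mem_index_enum.
by exists Y => //; rewrite setTI.
Qed.

Lemma measurable_fun_rV d (T : measurableType d) n (f : T -> 'rV[R]_n) :
  (forall i, measurable_fun [set: T] (fun x => f x 0 i)) ->
  measurable_fun [set: T] f.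
Proof.
move=> mf.
have : g_sigma_preimage (fun i => (fun x : 'rV[R]_n => x 0 i) \o f)
    `<=` measurable.
  apply: smallest_sub; first exact: sigma_algebra_measurable.
  case: n f mf => [|n] f mf; first by rewrite big_ord0.
  rewrite -bigcup_mkord_ord; apply: bigcup_sub => i Ii.
  by move=> A [B mB <-]; exact: mf.
rewrite g_sigma_preimage_comp => prefS _ A mA.
by apply: prefS; exists A.
Qed.

Lemma open_measurable_rV n (U : set 'rV[R]_n) : open U -> measurable U.
Proof.
move=> oU.
pose box (q : 'rV[rat]_n) (k : nat) : set 'rV[R]_n :=
  \bigcap_(i in [set: 'I_n])
    [set x | `|x 0 i - ratr (q 0 i)| < k.+1%:R^-1].
have mbox q k : measurable (box q k).
  apply: fin_bigcap_measurable => [|i _]; first exact: finite_finset.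
  rewrite [X in measurable X](_ : _ =
      (fun x : 'rV[R]_n => x 0 i) @^-1` ball (ratr (q 0 i) : R) k.+1%:R^-1).
    2: by apply/seteqP; split => x /=; rewrite -ball_normE /= distrC.
  rewrite -[X in measurable X]setTI; apply: measurable_coord => //.
  exact: measurable_ball.
have -> : U = \bigcup_(p in [set p : 'rV[rat]_n * nat | box p.1 p.2 `<=` U])
    box p.1 p.2.
  apply/seteqP; split => [x Ux|x [p /= pU]]; last exact: pU.
  have /nbhs_ballP[e /= e0 eU] : nbhs x U by exact: open_nbhs_nbhs.
  have [k ke] : exists k, k.+1%:R^-1 < e / 2.
    have e20 : 0 < e / 2 by rewrite divr_gt0.
    exists (Num.trunc (e / 2)^-1).
    rewrite invf_plt ?posrE// ?ltr0n//.
    by rewrite truncnS_gt.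
  have k0 : 0 < k.+1%:R^-1 :> R by rewrite invr_gt0.
  have qx i : {r : rat | `|x 0 i - ratr r| < k.+1%:R^-1}.
    apply: cid.
    have [r] := @dense_rat R (ball (x 0 i) k.+1%:R^-1)
      (ex_intro _ (x 0 i) (ballxx _ k0)) (ball_open _ _).
    by case=> + [q _ qr]; rewrite -ball_normE /= -qr => ?; exists q.
  exists (\row_i sval (qx i), k) => /=; last first.
    by move=> i _ /=; rewrite mxE; exact: svalP (qx i).
  move=> y yb; apply: eU; split=> // i j; rewrite ord1 -ball_normE /=.
  have := yb j Logic.I; rewrite /= mxE => yj.
  have xj := svalP (qx j).
  rewrite (splitr e) (le_lt_trans (ler_distD (ratr (sval (qx j))) _ _))//.
  by rewrite ltrD ?(lt_trans _ ke)// distrC.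
rewrite bigcup_mkcond; apply: countable_bigcupT_measurable.
  exact: countableP.
by move=> [q k]; case: ifP => // _; exact: mbox.
Qed.

(** Lebesgue measure on [R^n], as the iterated product measure. *)
Fixpoint leb n : set 'rV[R]_n -> \bar R :=
  if n is m.+1 return set 'rV[R]_n -> \bar R then
    pushforward (lebesgue_measure \x @leb m)%E
      (fun p : R * 'rV[R]_m => row_mx p.1%:M p.2 : 'rV[R]_m.+1)
  else \d_(0 : 'rV[R]_0).

Lemma leb_sigma_finite n :
  exists m : {sigma_finite_measure set 'rV[R]_n -> \bar R}, @leb n = m.
Proof.
elim: n => [|n [m IH]].
  have sf : sigma_finite setT (\d_(0 : 'rV[R]_0) : set _ -> \bar R).
    exact: sigma_finiteT.
  by exists (\d_(0 : 'rV[R]_0)).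
pose f (p : R * 'rV[R]_n) : 'rV[R]_n.+1 := row_mx p.1%:M p.2.
pose g (x : 'rV[R]_n.+1) : R * 'rV[R]_n :=
  (x 0 ord0, \row_i x 0 (lift ord0 i)).
have f0 p : f p 0 ord0 = p.1.
  rewrite /f mxE; case: splitP => // j; rewrite ord1 => _.
  by rewrite mxE mulr1n.
have fS p i : f p 0 (lift ord0 i) = p.2 0 i.
  rewrite /f mxE; case: splitP => [j|j]; first by rewrite ord1.
  by rewrite /= /bump/= !add1n => -[] /val_inj ->.
have fK : cancel f g.
  by move=> [t y]; rewrite /g f0; congr pair; apply/rowP => i; rewrite mxE fS.
have mf : measurable_fun setT f.
  apply: measurable_fun_rV => i.
  have [->|[j ->]] : i = ord0 \/ exists j, i = lift ord0 j.
    by case: (unliftP ord0 i) => [j ->|->]; [right; exists j|left].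
    rewrite (_ : (fun x => _) = fst); first exact: measurable_fst.
    by apply/funext => p; rewrite f0.
  rewrite (_ : (fun x => _) = (fun y : 'rV[R]_n => y 0 j) \o snd).
    exact: measurableT_comp (measurable_coord j) measurable_snd.
  by apply/funext => p; rewrite fS.
have mg : measurable_fun setT g.
  apply: measurable_fun_pair; first exact: measurable_coord.
  apply: measurable_fun_rV => i.
  rewrite (_ : (fun x => _) = fun x : 'rV[R]_n.+1 => x 0 (lift ord0 i)).
    exact: measurable_coord.
  by apply/funext => x; rewrite mxE.
pose mu : {measure set (measurableTypeR R * 'rV[R]_n)%type -> \bar R} :=
  (@lebesgue_measure R \x m)%E.
have sfmu : sigma_finite setT mu.
  have /sigma_finiteP[F [TF ndF Foo]] := sigma_finiteT (@lebesgue_measure R).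
  have /sigma_finiteP[G [TG ndG Goo]] := sigma_finiteT m.
  exists (fun n => F n `*` G n).
    rewrite -setXTT TF TG predeqE => -[x y]; split.
      move=> [/= [i _ Fnx] [k _ Gky]]; exists (maxn i k) => //; split.
      - by move: x Fnx; exact/subsetPset/ndF/leq_maxl.
      - by move: y Gky; exact/subsetPset/ndG/leq_maxr.
    by move=> [i _ []/= ? ?]; split; exists i.
  move=> k; have [? ?] := Foo k; have [? ?] := Goo k.
  split; first exact: measurableX.
  by rewrite /mu/= product_measure1E// lte_mul_pinfty// ge0_fin_numE.
pose nu : {measure set 'rV[R]_n.+1 -> \bar R} :=
  measure_function_pushforward__canonical__measure_function_Measure mu mf.
have nuE : @leb n.+1 = nu by rewrite /= IH.
have sf : sigma_finite setT nu.
  have [F FT Foo] := sfmu.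
  exists (fun i => g @^-1` F i).
    by rewrite -preimage_bigcup -FT preimage_setT.
  move=> i; have [mF Fi] := Foo i; split.
    by rewrite -[X in measurable X]setTI; exact: mg.
  rewrite [X in (X < _)%E](_ : _ = mu (F i))//.
  congr (mu _); apply/seteqP; split => p /=; by rewrite fK.
pose H1 := isSFinite.Build _ _ _ _ (sfinite_measure_sigma_finite sf).
pose H2 := isSigmaFinite.Build _ _ _ _ sf.
pose nu' := HB.pack_for (SigmaFiniteMeasure.type 'rV[R]_n.+1 R)
  (Measure.sort nu) H1 H2.
by exists nu'; rewrite nuE.
Qed.

Section leb_measure.
Variable n : nat.

Let leb0 : @leb n set0 = 0%E.
Proof. by have [m ->] := leb_sigma_finite n; exact: measure0. Qed.

Let leb_ge0 A : (0 <= @leb n A)%E.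
Proof. by have [m ->] := leb_sigma_finite n; exact: measure_ge0. Qed.

Let leb_sigma_additive : semi_sigma_additive (@leb n).
Proof.
by have [m ->] := leb_sigma_finite n; exact: measure_semi_sigma_additive.
Qed.

HB.instance Definition _ := isMeasure.Build _ _ _ (@leb n)
  leb0 leb_ge0 leb_sigma_additive.

Let leb_sf : sigma_finite setT (@leb n).
Proof. by have [m ->] := leb_sigma_finite n; exact: sigma_finiteT. Qed.

HB.instance Definition _ := Measure_isSigmaFinite.Build _ _ _ (@leb n) leb_sf.

End leb_measure.

End borel_rV_theory.

Arguments leb {R} n.

(** [some_or x0 P] is a point satisfying [P] if there is one, and [x0] otherwise.
    It names objects that are unique, possibly up to null sets. *)
Definition some_or {T : Type} (x0 : T) (P : T -> Prop) : T :=
  if pselect (exists x, P x) is left h then projT1 (cid h) else x0.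

(** * Euclidean structure; ['rV[R]_d] itself carries the sup norm *)

Section euclid.
Context {R : realType} {d : nat}.
Local Notation E := 'rV[R]_d.

Definition dot (x y : E) : R := \sum_i x 0 i * y 0 i.
Definition enorm (x : E) : R := Num.sqrt (dot x x).
Definition eball (x : E) (r : R) : set E := [set y | enorm (y - x) < r].
Definition sphere : set E := [set s | enorm s = 1].
Definition basis_vec (i : 'I_d) : E := delta_mx 0 i.

Definition frob (A B : 'M[R]_d) : R := \sum_i \sum_j A i j * B i j.
Definition sympart (A : 'M[R]_d) : 'M[R]_d := 2^-1 *: (A + A^T).
Definition outer (s t : E) : 'M[R]_d := s^T *m t.

Definition component (i : 'I_d) (F : E -> E) : E -> R := fun x => F x 0 i.

(** ** Classical derivatives *)

Definition partial (i : 'I_d) (f : E -> R) : E -> R :=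
  fun x => 'D_(basis_vec i) f x.
Definition jac (F : E -> E) (x : E) : 'M[R]_d :=
  \matrix_(i, j) partial j (component i F) x.
Definition divg (F : E -> E) (x : E) : R :=
  \sum_i partial i (component i F) x.
Definition egrad (f : E -> R) (x : E) : E := \row_i partial i f x.
(** [hess F x p j k] is the derivative in directions [j], [k] of [F_p]. *)
Definition hess (F : E -> E) (x : E) (p j k : 'I_d) : R :=
  partial j (partial k (component p F)) x.

Fixpoint Ck (k : nat) (f : E -> R) : Prop :=
  continuous f /\
  if k is k'.+1 then
    forall i, (forall x, derivable f x (basis_vec i)) /\ Ck k' (partial i f)
  else True.
Definition Cinfty (f : E -> R) : Prop := forall k, Ck k f.
Definition CkV (k : nat) (F : E -> E) : Prop :=
  forall i, Ck k (component i F).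

Definition supported_in (Omega : set E) (f : E -> R) : Prop :=
  exists K, [/\ compact K, K `<=` Omega & forall x, ~ K x -> f x = 0].
Definition Cc_infty (Omega : set E) (f : E -> R) : Prop :=
  Cinfty f /\ supported_in Omega f.
Definition Cc1V (Omega : set E) (F : E -> E) : Prop :=
  CkV 1 F /\ forall i, supported_in Omega (component i F).
(** For bounded open [Omega] this is the closure of [C_c(Omega)]. *)
Definition C0 (Omega : set E) (f : E -> R) : Prop :=
  continuous f /\ forall x, ~ Omega x -> f x = 0.

(** ** Smooth domains *)

Definition bdry (Omega : set E) : set E := closure Omega `\` Omega.

(** In the Euclidean ball [B(x, r)], [Omega] is the strict epigraph, in the
    direction [(-1)^b e_i], of a smooth function [gam] of the variables other
    than the [i]-th one. *)
Definition chart (Omega : set E) (x : E) (r : R) (i : 'I_d) (b : bool)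
    (gam : E -> R) : Prop :=
  [/\ 0 < r, Cinfty gam,
      forall y z : E, (forall j, j != i -> y 0 j = z 0 j) -> gam y = gam z &
      Omega `&` eball x r =
        [set y : E | gam y < (-1) ^+ b * y 0 i] `&` eball x r].

Definition smooth_domain (Omega : set E) : Prop :=
  [/\ open Omega, connected Omega, Omega !=set0, bounded_set Omega &
      forall x, bdry Omega x -> exists r i b gam, chart Omega x r i b gam].

Definition is_inner_normal (Omega : set E) (x n : E) : Prop :=
  bdry Omega x /\ exists r i b gam, chart Omega x r i b gam /\
    let v := (-1) ^+ b *: basis_vec i - egrad gam x in n = (enorm v)^-1 *: v.
Definition inner_normal (Omega : set E) (x : E) : E :=
  some_or 0 (is_inner_normal Omega x).

(** ** Hausdorff measure
    Given as the outer measure, which is a measure on Borel sets. *)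

Definition ediam (A : set E) : \bar R :=
  ereal_sup [set z | z = 0%E \/
    exists x y, [/\ A x, A y & z = (enorm (x - y))%:E]].
Definition hausdorff_const (s : nat) : R :=
  fine (leb s [set x : 'rV[R]_s |
    Num.sqrt (\sum_i x 0 i ^+ 2) <= 1]) / 2 ^+ s.
Definition hausdorff_pre (s : nat) (delta : R) (A : set E) : \bar R :=
  ereal_inf [set z | exists F : nat -> set E,
    [/\ A `<=` \bigcup_k F k, forall k, (ediam (F k) <= delta%:E)%E &
        z = (\sum_(0 <= k <oo)
               (hausdorff_const s)%:E * (ediam (F k)) ^+ s)%E]].
Definition hausdorff (s : nat) (A : set E) : \bar R :=
  ereal_sup [set hausdorff_pre s delta A | delta in [set delta : R | 0 < delta]].

Definition bint (Omega : set E) (f : E -> R) : R :=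
  fine (\int[hausdorff d.-1]_(x in bdry Omega) (f x)%:E)%E.

End euclid.

(** * Function spaces on a domain *)

(** Measurability of a class of functions up to null sets. *)
Definition ae_measurable {d1 d2} {T1 : measurableType d1}
    {T2 : measurableType d2} {R : realType} (mu : set T1 -> \bar R)
    (D : set T1) (f : T1 -> T2) : Prop :=
  exists g, measurable_fun D g /\ {ae mu, forall x, D x -> f x = g x}.

Definition L1 {d1} {T1 : measurableType d1} {R : realType}
    (mu : set T1 -> \bar R) (D : set T1) (f : T1 -> R) : Prop :=
  ae_measurable mu D f /\ (\int[mu]_(x in D) `|f x|%:E < +oo)%E.
Definition L2 {d1} {T1 : measurableType d1} {R : realType}
    (mu : set T1 -> \bar R) (D : set T1) (f : T1 -> R) : Prop :=
  ae_measurable mu D f /\ (\int[mu]_(x in D) (f x ^+ 2)%:E < +oo)%E.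

Section sobolev.
Context {R : realType} {d : nat} (Omega : set 'rV[R]_d).
Local Notation E := 'rV[R]_d.
Local Notation Leb := (leb d).

Definition L1loc (f : E -> R) : Prop :=
  forall K, compact K -> K `<=` Omega -> L1 Leb K f.

Definition is_weak_partial (i : 'I_d) (f g : E -> R) : Prop :=
  [/\ L1loc f, L1loc g &
      forall phi, Cc_infty Omega phi ->
        \int[Leb]_(x in Omega) (f x * partial i phi x) =
        - \int[Leb]_(x in Omega) (g x * phi x)].
Definition wpartial (i : 'I_d) (f : E -> R) : E -> R :=
  some_or (fun=> 0) (is_weak_partial i f).
Definition wgrad (f : E -> R) (x : E) : E := \row_i wpartial i f x.
Definition wjac (F : E -> E) (x : E) : 'M[R]_d :=
  \matrix_(i, j) wpartial j (component i F) x.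
Definition whess (F : E -> E) (x : E) (i j k : 'I_d) : R :=
  wpartial j (wpartial k (component i F)) x.
Definition strain (F : E -> E) (x : E) : 'M[R]_d := sympart (wjac F x).

Definition H1 (f : E -> R) : Prop :=
  L2 Leb Omega f /\
  forall i, exists g, is_weak_partial i f g /\ L2 Leb Omega g.
Definition H2 (f : E -> R) : Prop := H1 f /\ forall i, H1 (wpartial i f).
Definition H1V (F : E -> E) : Prop := forall i, H1 (component i F).
Definition H2V (F : E -> E) : Prop := forall i, H2 (component i F).

Definition H1ip (f g : E -> R) : R :=
  \int[Leb]_(x in Omega) (f x * g x + dot (wgrad f x) (wgrad g x)).
Definition H1norm (f : E -> R) : R := Num.sqrt (H1ip f f).
Definition H1Vip (F G : E -> E) : R :=
  \sum_i H1ip (component i F) (component i G).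
Definition H1Vnorm (F : E -> E) : R := Num.sqrt (H1Vip F F).
Definition hess_sq (F : E -> E) (x : E) : R :=
  \sum_i \sum_j \sum_k whess F x i j k ^+ 2.
Definition H2Vnorm (F : E -> E) : R :=
  Num.sqrt (H1Vip F F + \int[Leb]_(x in Omega) hess_sq F x).

Definition H1perp (F : E -> E) : Prop :=
  H1V F /\
  forall G, H1V G -> {ae Leb, forall x, Omega x -> strain G x = 0} ->
    H1Vip F G = 0.

(** Mean-zero functions, their dual and the Neumann Laplacian; an element of
    the dual is a functional whose values outside [H1mean] are irrelevant. *)
Definition H1mean (f : E -> R) : Prop :=
  H1 f /\ \int[Leb]_(x in Omega) f x = 0.
Definition Hm1 (ell : (E -> R) -> R) : Prop :=
  (forall a f g, H1mean f -> H1mean g ->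
     ell (a *: f + g) = a * ell f + ell g) /\
  (exists C, forall f, H1mean f -> `|ell f| <= C * H1norm f).
Definition gradL2 (f : E -> R) : R :=
  Num.sqrt (\int[Leb]_(x in Omega) dot (wgrad f x) (wgrad f x)).
Definition invNeumann (ell : (E -> R) -> R) : E -> R :=
  some_or (fun=> 0) (fun v => H1mean v /\ forall xi, H1mean xi ->
    \int[Leb]_(x in Omega) dot (wgrad v x) (wgrad xi x) = ell xi).
Definition Hm1norm (ell : (E -> R) -> R) : R := gradL2 (invNeumann ell).
Definition toHm1 (f : E -> R) : (E -> R) -> R :=
  fun xi => \int[Leb]_(x in Omega) (f x * xi x).

(** ** Functions of bounded variation
    The measure [grad f] is represented by its polar decomposition
    [(|grad f|, grad f / |grad f|)], with [|grad f|] a measure on [R^d] that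
    vanishes outside [Omega]. *)

Definition is_BVgrad (f : E -> R)
    (D : {finite_measure set E -> \bar R} * (E -> E)) : Prop :=
  [/\ D.1 (~` Omega) = 0%E, measurable_fun setT D.2,
      {ae D.1, forall x, enorm (D.2 x) = 1} &
      forall phi, Cc1V Omega phi ->
        \int[Leb]_(x in Omega) (f x * divg phi x) =
        - \int[D.1]_(x in Omega) dot (phi x) (D.2 x)].
Definition BVgrad (f : E -> R) : {finite_measure set E -> \bar R} * (E -> E) :=
  some_or (mzero : {finite_measure set E -> \bar R}, (fun=> 0) : E -> E)
    (is_BVgrad f).
(** [|grad f|] and [int_Omega eta . d(grad f)] *)
Definition BVvar (f : E -> R) : {finite_measure set E -> \bar R} :=
  (BVgrad f).1.
Definition BVint (f : E -> R) (eta : E -> E) : R :=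
  \int[BVvar f]_(x in Omega) dot (eta x) ((BVgrad f).2 x).

Definition BV (f : E -> R) : Prop := L1 Leb Omega f /\ exists D, is_BVgrad f D.
Definition BV01 (f : E -> R) : Prop :=
  BV f /\ {ae Leb, forall x, Omega x -> f x = 0 \/ f x = 1}.
Definition BVnorm (f : E -> R) : R :=
  \int[Leb]_(x in Omega) `|f x| + fine (BVvar f Omega).

(** Boundary trace, characterized by the Gauss-Green formula. *)
Definition is_trace (f h : E -> R) : Prop :=
  L1 (hausdorff d.-1) (bdry Omega) h /\
  forall eta, CkV 1 eta ->
    \int[Leb]_(x in Omega) (f x * divg eta x) =
    - BVint f eta - bint Omega (fun x => h x * dot (eta x) (inner_normal Omega x)).
Definition trace (f : E -> R) : E -> R := some_or (fun=> 0) (is_trace f).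

(** Sets of finite perimeter (De Giorgi): [is_normal A x nu] says that [x] is
    in the reduced boundary of [A], with interior normal [nu]. *)
Definition finite_perimeter (A : set E) : Prop := BV \1_A.
Definition perimeter_avg (A : set E) (x : E) (r : R) : E :=
  let D := BVgrad \1_A in
  (fine (D.1 (eball x r)))^-1 *:
    \row_i \int[D.1]_(y in eball x r) (D.2 y 0 i).
Definition is_normal (A : set E) (x nu : E) : Prop :=
  [/\ Omega x, forall r, 0 < r -> (0 < BVvar \1_A (eball x r))%E,
      perimeter_avg A x r @[r --> 0^'+] --> nu & enorm nu = 1].
Definition reduced_boundary (A : set E) : set E :=
  [set x | exists nu, is_normal A x nu].
Definition normal (A : set E) (x : E) : E := some_or 0 (is_normal A x).

End sobolev.

(** * Bochner spaces on a time interval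
    [X] is a subspace of [V] and [N] its norm; functions in [X] that are at
    [N]-distance [0] represent the same element. *)

Section bochner.
Context {R : realType} {V : lmodType R} (X : V -> Prop) (N : V -> R).
Local Notation mu1 := (@lebesgue_measure R).

Record simple_fun := SimpleFun {
  sf_size : nat;
  sf_set : 'I_sf_size -> set R;
  sf_val : 'I_sf_size -> V }.
Definition is_simple (s : simple_fun) : Prop :=
  forall i, measurable (@sf_set s i) /\ X (@sf_val s i).
Definition sf_eval (s : simple_fun) (t : R) : V :=
  \sum_i (\1_(@sf_set s i) t : R) *: @sf_val s i.
Definition sf_integral (I : set R) (s : simple_fun) : V :=
  \sum_i fine (mu1 (@sf_set s i `&` I)) *: @sf_val s i.

Definition approximates (I : set R) (s : nat -> simple_fun) (f : R -> V) :=
  (forall k, is_simple (s k)) /\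
  {ae mu1, forall t, I t ->
    X (f t) /\ N (sf_eval (s k) t - f t) @[k --> \oo] --> (0 : R)}.
Definition strongly_measurable (I : set R) (f : R -> V) : Prop :=
  exists s, approximates I s f.
Definition is_bochner_integral (I : set R) (f : R -> V) (v : V) : Prop :=
  X v /\ exists s, [/\ approximates I s f,
    (\int[mu1]_(t in I) (N (sf_eval (s k) t - f t))%:E)%E @[k --> \oo] --> 0%E &
    N (sf_integral I (s k) - v) @[k --> \oo] --> (0 : R)].

Context (T : R).
Local Notation IT := (`]0, T[%classic : set R).

Definition L2t (f : R -> V) : Prop :=
  strongly_measurable IT f /\
  (\int[mu1]_(t in IT) ((N (f t)) ^+ 2)%:E < +oo)%E.
Definition Linft (f : R -> V) : Prop :=
  strongly_measurable IT f /\
  exists M : R, {ae mu1, forall t, IT t -> N (f t) <= M}.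

Definition time_test (phi : R -> R) : Prop :=
  (forall k t, derivable (derive1n k phi) t 1) /\
  exists a b, [/\ 0 < a, b < T & forall t, phi t != 0 -> a <= t <= b].
Definition is_time_deriv (f g : R -> V) : Prop :=
  L2t g /\ forall phi, time_test phi -> exists v,
    is_bochner_integral IT (fun t => derive1 phi t *: f t) v /\
    is_bochner_integral IT (fun t => phi t *: g t) (- v).
Definition time_deriv (f : R -> V) : R -> V :=
  some_or (fun=> 0) (is_time_deriv f).
Definition H1t (f : R -> V) : Prop :=
  L2t f /\ exists g, is_time_deriv f g.

(** [f(0) = f0] for the continuous representative [fc] of [f]. *)
Definition initial_value (f : R -> V) (f0 : V) : Prop :=
  X f0 /\ exists fc : R -> V,
    [/\ forall t, 0 <= t < T -> X (fc t),
        forall t, 0 <= t < T -> forall e, 0 < e -> exists2 delta, 0 < delta &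
          forall s, 0 <= s < T -> `|s - t| < delta -> N (fc s - fc t) < e,
        {ae mu1, forall t, IT t -> N (fc t - f t) = 0} &
        N (fc 0 - f0) = 0].

End bochner.

(** * Oriented varifolds
    Measures on [closure Omega * S^(d-1)] or [bdry Omega * S^(d-1)] are
    measures on [R^d * R^d] vanishing outside that set. *)

Section varifolds.
Context {R : realType} {d : nat}.
Local Notation E := 'rV[R]_d.

Definition oriented_varifold (U : set E) (V : {measure set (E * E)%type -> \bar R})
  : Prop := (V setT < +oo)%E /\ V (~` (U `*` sphere)) = 0%E.

Definition mass (V : {measure set (E * E)%type -> \bar R}) (U : set E) : \bar R :=
  V (U `*` sphere).

Section mass_measure.
Variable V : {measure set (E * E)%type -> \bar R}.

Lemma measurable_sphere : measurable (sphere : set E).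
Proof.
have mdot : measurable_fun setT (fun x : E => dot x x).
  apply: measurable_sum => i; apply: measurable_funM; exact: measurable_coord.
rewrite (_ : sphere = (fun x : E => dot x x) @^-1` [set 1]).
  by rewrite -[X in measurable X]setTI; exact: mdot.
apply/seteqP; split => x; rewrite /sphere /enorm /=; last by move->; rewrite sqrtr1.
move=> x1; have x0 : 0 <= dot x x.
  by apply: sumr_ge0 => i _; rewrite -expr2 sqr_ge0.
by rewrite -(sqr_sqrtr x0) x1 expr1n.
Qed.

Let mass0 : mass V set0 = 0%E.
Proof. by rewrite /mass set0X measure0. Qed.

Let mass_ge0 U : (0 <= mass V U)%E.
Proof. exact: measure_ge0. Qed.

Let mass_sigma_additive : semi_sigma_additive (mass V).
Proof.
move=> F mF tF mUF; rewrite /mass setX_bigcupl.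
apply: measure_semi_sigma_additive.
- by move=> n; apply: measurableX => //; exact: measurable_sphere.
- apply/trivIsetP => i j _ _ ij; rewrite -setXI.
  by move/trivIsetP : tF => /(_ _ _ _ _ ij) ->//; rewrite set0X.
- rewrite -setX_bigcupl; apply: measurableX => //; exact: measurable_sphere.
Qed.

HB.instance Definition _ := isMeasure.Build _ _ _ (mass V)
  mass0 mass_ge0 mass_sigma_additive.

End mass_measure.

(** [V = sigma (x) (omega_x)] *)
Definition disintegrates (V : {measure set (E * E)%type -> \bar R})
    (sigma : set E -> \bar R) (omega : E -> {measure set E -> \bar R}) : Prop :=
  forall f : E * E -> \bar R, measurable_fun setT f ->
    (forall p, 0 <= f p)%E ->
    ae_measurable sigma setT (fun x => \int[omega x]_s f (x, s))%E /\
    (\int[V]_p f p = \int[sigma]_x \int[omega x]_s f (x, s))%E.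

Definition probability_on_sphere (P : {measure set E -> \bar R}) : Prop :=
  P sphere = 1%E /\ P (~` sphere) = 0%E.

Definition barycenter (P : {measure set E -> \bar R}) : E :=
  \row_i \int[P]_(s in sphere) (s 0 i).

End varifolds.

(** * The regularized visco-elastic Mullins-Sekerka system *)

Section system.
Context {R : realType} {d : nat}.
Local Notation E := 'rV[R]_d.
Local Notation Leb := (leb d).
Local Notation mu1 := (@lebesgue_measure R).
Local Notation varifold := {measure set (E * E)%type -> \bar R}.

Record elastic_data := ElasticData {
  stiffness : R -> 'M[R]_d -> 'M[R]_d;
  viscosity : R -> 'M[R]_d -> 'M[R]_d;
  eigenstrain : R -> 'M[R]_d }.

Definition sym_mx (A : 'M[R]_d) : Prop := A^T = A.

Definition symmetric_endo (L : 'M[R]_d -> 'M[R]_d) : Prop :=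
  [/\ forall A, sym_mx A -> sym_mx (L A),
      forall a A B, sym_mx A -> sym_mx B -> L (a *: A + B) = a *: L A + L B &
      forall A B, sym_mx A -> sym_mx B -> frob (L A) B = frob A (L B)].

Definition elastic_ok (e : elastic_data) : Prop :=
  [/\ forall y, symmetric_endo (stiffness e y),
      forall y, symmetric_endo (viscosity e y),
      forall y, sym_mx (eigenstrain e y) &
      exists2 c, 0 < c & forall y A, sym_mx A ->
        c * frob A A <= frob (stiffness e y A) A /\
        c * frob A A <= frob (viscosity e y A) A].

Definition Wel (e : elastic_data) (y : R) (A : 'M[R]_d) : R :=
  2^-1 * frob (stiffness e y (A - eigenstrain e y)) (A - eigenstrain e y).
Definition dWel (e : elastic_data) (y : R) (A : 'M[R]_d) : 'M[R]_d :=
  stiffness e y (A - eigenstrain e y).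

(** [muO_dis] is the family [mu^Omega_(t,x)] in the disintegration of
    [mu^Omega_t]. *)
Record candidate := Candidate {
  mu : R -> varifold;
  muO : R -> varifold;
  muO_dis : R -> E -> {measure set E -> \bar R};
  muB : R -> varifold;
  chi : R -> E -> R;
  u : R -> E -> E }.

(** [C^1] functions on [R * R^d]; see [weak_test] for the supports. *)
Definition C1_time_space (zeta : R -> E -> R) : Prop :=
  [/\ continuous (fun p : R * E => zeta p.1 p.2),
      (forall t x, derivable (zeta^~ x) t 1) /\
      continuous (fun p : R * E => derive1 (zeta^~ p.2) p.1) &
      forall i, (forall t x, derivable (zeta t) x (basis_vec i)) /\
        continuous (fun p : R * E => partial i (zeta p.1) p.2)].

Section solution.
Variables (Omega : set E) (T c0 alpha : R) (e : elastic_data).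
Local Notation IT := (`]0, T[%classic : set R).
Local Notation nOmega := (inner_normal Omega).
Local Notation wjac := (wjac Omega).
Local Notation whess := (whess Omega).
Local Notation strain := (strain Omega).

Definition initial_ok (chi0 : E -> R) (u0 : E -> E) : Prop :=
  [/\ BV01 Omega chi0,
      0 < \int[Leb]_(x in Omega) chi0 x,
      ((\int[Leb]_(x in Omega) chi0 x)%:E < Leb Omega)%E,
      H1perp Omega u0 & H2V Omega u0].

(** Functions in [C^1_c([0, T) * Omega)]. *)
Definition weak_test (zeta : R -> E -> R) : Prop :=
  C1_time_space zeta /\ exists K b,
    [/\ compact K, K `<=` Omega, b < T &
        forall t x, 0 <= t -> zeta t x != 0 -> t <= b /\ K x].

Definition energy0 (chi0 : E -> R) (u0 : E -> E) : R :=
  c0 * fine (BVvar Omega chi0 Omega)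
  + bint Omega (fun x => c0 * cos alpha * trace Omega chi0 x)
  + \int[Leb]_(x in Omega) Wel e (chi0 x) (strain u0 x)
  + \int[Leb]_(x in Omega) (2^-1 * hess_sq Omega u0 x).

Section candidate_fields.
Variable s : candidate.

Definition massO (t : R) : set E -> \bar R := mass (muO s t).
Definition massB (t : R) : set E -> \bar R := mass (muB s t).

Definition dtu : R -> E -> E :=
  time_deriv (H1perp Omega) (H1Vnorm Omega) T (u s).
Definition dtchi : R -> (E -> R) -> R :=
  time_deriv (Hm1 Omega) (Hm1norm Omega) T (fun t => toHm1 Omega (chi s t)).

Definition viscous_stress (t : R) (x : E) : 'M[R]_d :=
  viscosity e (chi s t x) (strain (dtu t) x).
Definition elastic_stress (t : R) (x : E) : 'M[R]_d :=
  dWel e (chi s t x) (strain (u s t) x).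

Definition dissipation_u (t : R) : R :=
  \int[Leb]_(x in Omega)
    frob (viscosity e (chi s t x) (strain (dtu t) x)) (strain (dtu t) x).

Definition energy (t : R) : R :=
  fine (mass (mu s t) (closure Omega))
  + \int[Leb]_(x in Omega) Wel e (chi s t x) (strain (u s t) x)
  + \int[Leb]_(x in Omega) (2^-1 * hess_sq Omega (u s t) x).

Definition chi_regular : Prop :=
  [/\ exists M : R, {ae mu1, forall t, IT t ->
        BV01 Omega (chi s t) /\ BVnorm Omega (chi s t) <= M},
      forall phi, C0 Omega phi ->
        ae_measurable mu1 IT
          (fun t => \int[Leb]_(x in Omega) (chi s t x * phi x) : R),
      forall eta, (forall i, C0 Omega (component i eta)) ->
        ae_measurable mu1 IT (fun t => BVint Omega (chi s t) eta : R) &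
      H1t (Hm1 Omega) (Hm1norm Omega) T (fun t => toHm1 Omega (chi s t))].

Definition varifold_structure : Prop :=
  exists g : R * E -> R,
  [/\ ae_measurable (mu1 \x hausdorff d.-1)%E (IT `*` bdry Omega) g,
      forall p, 0 <= g p <= 1 &
      {ae mu1, forall t, IT t ->
        [/\ forall A, measurable A ->
              mu s t A = (c0%:E * muO s t A + (c0 * cos alpha)%:E * muB s t A)%E,
            oriented_varifold (closure Omega) (muO s t) /\
            oriented_varifold (bdry Omega) (muB s t),
            disintegrates (muO s t) (massO t) (muO_dis s t) /\
            {ae massO t, forall x, probability_on_sphere (muO_dis s t x)},
            disintegrates (muB s t) (massB t) (fun x => \d_(nOmega x)) &
            forall A, measurable A ->
              massB t A =
              (\int[hausdorff d.-1]_(x in A `&` bdry Omega) (g (t, x))%:E)%E]}].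

Definition compatibility (t : R) : Prop :=
  [/\ forall eta, CkV 1 eta ->
        (forall x, bdry Omega x -> dot (eta x) (nOmega x) = 0) ->
        \int[muO s t]_(p in closure Omega `*` sphere) dot (eta p.1) p.2 =
        BVint Omega (chi s t) eta,
      forall xi, CkV 1 xi ->
        (forall x, bdry Omega x -> dot (xi x) (nOmega x) = cos alpha) ->
        - (\int[muO s t]_(p in closure Omega `*` sphere) dot p.2 (xi p.1)) =
        - BVint Omega (chi s t) xi
        + cos alpha * (fine (massB t (bdry Omega))
                       - bint Omega (trace Omega (chi s t))) &
      forall A, measurable A ->
        ((cos alpha)%:E *
           \int[hausdorff d.-1]_(x in A `&` bdry Omega)
             (trace Omega (chi s t) x)%:E <=
         (cos alpha)%:E * (massO t (A `&` bdry Omega) + massB t A))%E].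

Definition first_variation_rhs (w : R -> E -> R) (t : R) (B : E -> E) : R :=
  \int[Leb]_(x in Omega)
    (chi s t x * \sum_i wpartial Omega i (fun y => w t y * B y 0 i) x)
  + \int[Leb]_(x in Omega) frob (viscous_stress t x)
      (\matrix_(i, j) \sum_k whess (u s t) x i j k * B x 0 k)
  - \int[Leb]_(x in Omega) (2^-1 * hess_sq Omega (u s t) x * divg B x)
  - \int[Leb]_(x in Omega) frob
      ((Wel e (chi s t x) (strain (u s t) x))%:M
       - (wjac (u s t) x)^T *m (viscous_stress t x + elastic_stress t x))
      (jac B x)
  + \int[Leb]_(x in Omega)
      (\sum_i \sum_j \sum_k \sum_p
         whess (u s t) x i j k * wjac (u s t) x i p * hess B x p j k)
  + \int[Leb]_(x in Omega)
      (\sum_i \sum_j \sum_k \sum_p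
         whess (u s t) x i j k *
         (whess (u s t) x i p k * jac B x j p
          + whess (u s t) x i j p * jac B x k p)).

Definition gibbs_thomson (w : R -> E -> R) : Prop :=
  {ae mu1, forall t, IT t -> forall B, CkV 2 B ->
    (forall x, bdry Omega x -> dot (B x) (nOmega x) = 0) ->
    \int[mu s t]_(p in closure Omega `*` sphere)
      frob (1%:M - outer p.2 p.2) (jac B p.1) =
    first_variation_rhs w t B}.

Definition evolution (chi0 : E -> R) : Prop :=
  let v t := - invNeumann Omega (dtchi t) in
  [/\ L2t (H1mean Omega) (H1norm Omega) T v,
      forall zeta, weak_test zeta ->
        H1t (H1mean Omega) (H1norm Omega) T zeta ->
        \int[mu1]_(t in IT)
          (\int[Leb]_(x in Omega) (chi s t x * derive1 (zeta^~ x) t))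
        - \int[mu1]_(t in IT)
          (\int[Leb]_(x in Omega) dot (wgrad Omega (v t) x) (egrad (zeta t) x))
        = - \int[Leb]_(x in Omega) (chi0 x * zeta 0 x) &
      {ae mu1, forall t, IT t ->
        \int[Leb]_(x in Omega) chi s t x = \int[Leb]_(x in Omega) chi0 x}].

Definition momentum : Prop :=
  forall z : R -> E -> E, L2t (H2V Omega) (H2Vnorm Omega) T z ->
    \int[mu1]_(t in IT) (\int[Leb]_(x in Omega)
      (frob (viscous_stress t x + elastic_stress t x) (strain (z t) x)
       + \sum_i \sum_j \sum_k whess (u s t) x i j k * whess (z t) x i j k)) = 0.

Definition energy_inequality (w : R -> E -> R) (chi0 : E -> R) (u0 : E -> E)
  : Prop :=
  {ae mu1, forall a, {ae mu1, forall b, 0 < a -> a <= b -> b < T ->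
    energy b
    + 2^-1 * \int[mu1]_(t in `]a, b[)
               (Hm1norm Omega (dtchi t) ^+ 2 + dissipation_u t)
    + 2^-1 * \int[mu1]_(t in `]a, b[)
               (gradL2 Omega (w t) ^+ 2 + dissipation_u t)
    <= energy a /\ energy a <= energy0 chi0 u0}}.

End candidate_fields.

Record varifold_solution (chi0 : E -> R) (u0 : E -> E) (s : candidate) : Prop :=
  VarifoldSolution {
  vs_chi_01 : forall t x, IT t -> Omega x -> chi s t x = 0 \/ chi s t x = 1;
  vs_chi_measurable :
    ae_measurable (mu1 \x Leb)%E (IT `*` Omega) (fun p => chi s p.1 p.2 : R);
  vs_mu_varifold : forall t, IT t -> oriented_varifold (closure Omega) (mu s t);
  vs_chi_regular : chi_regular s;
  vs_u_H1 : H1t (H1perp Omega) (H1Vnorm Omega) T (u s);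
  vs_u_H2 : Linft (H2V Omega) (H2Vnorm Omega) T (u s);
  vs_chi_init : initial_value (Hm1 Omega) (Hm1norm Omega) T
    (fun t => toHm1 Omega (chi s t)) (toHm1 Omega chi0);
  vs_u_init : initial_value (H1perp Omega) (H1Vnorm Omega) T (u s) u0;
  vs_structure : varifold_structure s;
  vs_compatibility : {ae mu1, forall t, IT t -> compatibility s t};
  vs_potential : exists w : R -> E -> R,
    [/\ L2t (H1 Omega) (H1norm Omega) T w, gibbs_thomson s w &
        energy_inequality s w chi0 u0];
  vs_evolution : evolution s chi0;
  vs_momentum : momentum s;
  vs_mass_measurable :
    ae_measurable mu1 IT (fun t => mass (mu s t) (closure Omega)) }.

End solution.
End system.

(* Main.v *)
From HB Require Import structures.
Require Import Defs.
From mathcomp Require Import all_boot all_order all_algebra.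
From mathcomp Require Import all_classical all_reals all_analysis measurable_realfun.
From mathcomp Require Import ring lra.
Import Order.TTheory GRing.Theory Num.Theory.
Import numFieldNormedType.Exports.
Local Open Scope classical_set_scope.
Local Open Scope ring_scope.

(** Fix a time, let [V] be the interior varifold at that time, [sigma] its
    mass measure, [b x] the barycenter of the fiber measure at [x], and let
    [(m, nu)] be the polar decomposition of [grad chi]. The whole statement
    follows from the identity of vector measures [b sigma = nu m] on [Omega].

    The identity comes from the compatibility condition with test fields
    [phi e_i], where [phi] is a [C^1] function with compact support in
    [Omega]: the disintegration turns its left-hand side into the integral of
    [phi b_i] against [sigma] ([barycenter_representative]), and bump functions
    that converge to indicators of boxes ([box_bumps]), together with the
    pi-lambda theorem ([charge_eq0_open]), give equality on all Borel subsets
    of [Omega]. Since [nu] has norm 1, [m] is then absolutely continuous with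
    respect to [sigma], and its Radon-Nikodym density [h] satisfies
    [b = h nu] for [sigma]-almost every point ([vector_measures_polar]).
    Barycenters of probability measures on the sphere have norm at most 1, so
    [h <= 1], and [theta] is the norm of [b].

    It remains to see that [nu] is the measure theoretic normal and that [m]
    does not charge the complement of the reduced boundary
    ([reduced_boundary_ae]). By definition of the reduced boundary this says
    that averages of [nu] over small Euclidean balls converge to [nu] for
    [m]-almost every point. As [m] need not be doubling, this is the
    Lebesgue-Besicovitch theorem. The usual infinite covering theorem is
    avoided: finitely many centers from a fine grid, from which balls are
    selected greedily by decreasing radius, already give the weak type estimate
    for the centered maximal function ([weak_type]), because the number
    of selected balls that meet at a point is bounded in terms of the dimension
    ([bounded_overlap]). With outer regularity the estimate yields density
    points ([density]), hence convergence of averages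
    ([lebesgue_besicovitch]).

    Finally, if [sigma] and [m] give the same mass to [Omega], then
    [1 - h >= 0] has integral 0 over [Omega], so [b] is a unit vector almost
    everywhere. This is the equality case of the Cauchy-Schwarz inequality,
    and the fiber measure is the Dirac mass at [b = nu]
    ([unit_barycenter_dirac]). *)

Set Implicit Arguments.
Unset Strict Implicit.
Unset Printing Implicit Defensive.

(** * Euclidean geometry *)

Section euclidean_norm.
Context {R : realType} {d : nat}.
Implicit Types x y z : 'rV[R]_d.

Lemma dotC x y : dot x y = dot y x.
Proof. by apply: eq_bigr => i _; rewrite mulrC. Qed.

Lemma dotDl x y z : dot (x + y) z = dot x z + dot y z.
Proof. by rewrite /dot -big_split; apply: eq_bigr => i _; rewrite mxE mulrDl. Qed.

Lemma dotZl a x y : dot (a *: x) y = a * dot x y.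
Proof. by rewrite /dot mulr_sumr; apply: eq_bigr => i _; rewrite mxE mulrA. Qed.

Lemma dotBl x y z : dot (x - y) z = dot x z - dot y z.
Proof. by rewrite -scaleN1r dotDl dotZl mulN1r. Qed.

Lemma dotBr x y z : dot x (y - z) = dot x y - dot x z.
Proof. by rewrite dotC dotBl !(dotC x). Qed.

Lemma dotZr a x y : dot x (a *: y) = a * dot x y.
Proof. by rewrite dotC dotZl dotC. Qed.

Lemma dot_ge0 x : 0 <= dot x x.
Proof. by apply: sumr_ge0 => i _; rewrite -expr2 sqr_ge0. Qed.

Lemma dot_eq0 x : dot x x = 0 -> x = 0.
Proof.
move=> /eqP; rewrite psumr_eq0 => [/allP x0|i _]; last by rewrite -expr2 sqr_ge0.
apply/rowP => i; rewrite mxE; have := x0 i.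
by rewrite mem_index_enum -expr2 sqrf_eq0 => /(_ isT)/eqP.
Qed.

Lemma enorm_ge0 x : 0 <= enorm x. Proof. exact: sqrtr_ge0. Qed.

Lemma enorm_sqr x : enorm x ^+ 2 = dot x x.
Proof. by rewrite sqr_sqrtr // dot_ge0. Qed.

Lemma enorm0 : enorm (0 : 'rV[R]_d) = 0.
Proof. by rewrite /enorm /dot big1 ?sqrtr0// => i _; rewrite mxE mul0r. Qed.

Lemma enorm_eq0 x : enorm x = 0 -> x = 0.
Proof. by move=> x0; apply: dot_eq0; rewrite -enorm_sqr x0 expr0n. Qed.

Lemma enorm_Z a x : 0 <= a -> enorm (a *: x) = a * enorm x.
Proof.
move=> a0; rewrite /enorm dotZl dotZr mulrA -expr2 sqrtrM ?sqr_ge0//.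
by rewrite sqrtr_sqr ger0_norm.
Qed.

Lemma enormN x : enorm (- x) = enorm x.
Proof. by rewrite /enorm -scaleN1r dotZl dotZr; congr Num.sqrt; ring. Qed.

Lemma enorm_distC x y : enorm (x - y) = enorm (y - x).
Proof. by rewrite -enormN opprB. Qed.

Lemma enormB_sqr x y :
  enorm (x - y) ^+ 2 = enorm x ^+ 2 + enorm y ^+ 2 - 2 * dot x y.
Proof. by rewrite !enorm_sqr !(dotBl, dotBr) (dotC y x); ring. Qed.

Lemma norm_dot_le_enorm x y : `|dot x y| <= enorm x * enorm y.
Proof.
have [Y0|Y0] := leP (dot y y) 0.
  have /dot_eq0 -> : dot y y = 0 by apply/le_anti; rewrite Y0 dot_ge0.
  by rewrite enorm0 mulr0 dotC /dot big1 ?normr0// => i _; rewrite mxE mul0r.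
have CS : dot x y ^+ 2 <= dot x x * dot y y.
  have := dot_ge0 (dot y y *: x - dot x y *: y).
  rewrite !(dotBl, dotBr, dotZl, dotZr) (dotC y x) => H.
  rewrite -subr_ge0 -(pmulr_rge0 _ Y0); apply: le_trans H _.
  by rewrite le_eqVlt; apply/orP; left; apply/eqP; ring.
by rewrite -sqrtr_sqr -sqrtrM ?dot_ge0// ler_wsqrtr.
Qed.

Lemma dot_le_enorm x y : dot x y <= enorm x * enorm y.
Proof. exact: le_trans (ler_norm _) (norm_dot_le_enorm x y). Qed.

Lemma enormD x y : enorm (x + y) <= enorm x + enorm y.
Proof.
rewrite -(@ler_pXn2r _ 2) ?nnegrE ?addr_ge0 ?enorm_ge0//.
rewrite sqrrD !enorm_sqr dotDl !(dotC _ (x + y)) !dotDl (dotC y x).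
have := dot_le_enorm x y; lra.
Qed.

(** Opposite to the longest side of a triangle is an angle of at least 60
    degrees, and unit vectors at such an angle have distance at least 1. *)
Lemma wide_angle x y : x != 0 -> y != 0 ->
  enorm x < enorm (x - y) -> enorm y < enorm (x - y) ->
  1 <= enorm ((enorm x)^-1 *: x - (enorm y)^-1 *: y).
Proof.
move=> x0 y0.
have {}x0 : 0 < enorm x.
  by rewrite lt0r enorm_ge0 andbT; apply: contra_neq x0 => /enorm_eq0.
have {}y0 : 0 < enorm y.
  by rewrite lt0r enorm_ge0 andbT; apply: contra_neq y0 => /enorm_eq0.
rewrite -(@ltr_pXn2r _ 2) ?nnegrE ?enorm_ge0//.
rewrite -(@ltr_pXn2r _ 2 _ (enorm y)) ?nnegrE ?enorm_ge0//.
rewrite -(@ler_pXn2r _ 2 _ 1) ?nnegrE ?enorm_ge0// expr1n !enormB_sqr.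
rewrite !enorm_Z ?invr_ge0 ?enorm_ge0// !mulVf ?gt_eqF// dotZl dotZr.
set a := enorm x in x0 *; set b := enorm y in y0 *; set D := dot _ _.
rewrite (_ : a^-1 * _ = D / (a * b)); last by field; rewrite !gt_eqF.
move=> H1 H2; have Dab : 2 * D <= a * b.
  rewrite leNgt; apply/negP => Dab; move: H1 H2 Dab.
  have [ab|ba] := leP a b.
  - have : a ^+ 2 <= a * b by rewrite expr2 ler_wpM2l// ltW.
    lra.
  - have : b ^+ 2 <= a * b by rewrite expr2 ler_wpM2r ?ltW.
    lra.
have : D / (a * b) <= 2^-1 by rewrite ler_pdivrMr ?mulr_gt0//; lra.
lra.
Qed.

Lemma coord_le_enorm x i : `|x 0 i| <= enorm x.
Proof.
rewrite -sqrtr_sqr ler_wsqrtr// /dot (bigD1 i)//= -expr2 lerDl.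
by apply: sumr_ge0 => j _; rewrite -expr2 sqr_ge0.
Qed.

Lemma measurable_eball x (r : R) : measurable (eball x r).
Proof.
have m : measurable_fun setT (fun y : 'rV[R]_d => enorm (y - x)).
  apply: (@measurableT_comp _ _ _ _ _ _ (@Num.sqrt R)) => //.
    by apply: continuous_measurable_fun; exact: sqrt_continuous.
  rewrite /dot; apply: measurable_sum => i.
  have mi : measurable_fun setT (fun y : 'rV[R]_d => (y - x) 0 i).
    under eq_fun do rewrite !mxE.
    by apply: measurable_funB => //; exact: measurable_coord.
  exact: measurable_funM.
have -> : eball x r = (fun y => enorm (y - x)) @^-1` `]-oo, r[.
  by apply/seteqP; split => y; rewrite /eball/= in_itv.
by rewrite -[X in measurable X]setTI; exact: m.
Qed.

Lemma open_eball x (U : set 'rV[R]_d) : open U -> U x ->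
  exists2 r : R, 0 < r & eball x r `<=` U.
Proof.
move=> oU Ux; have /nbhs_ballP[e /= e0 eU] := open_nbhs_nbhs (conj oU Ux).
exists e => // y yx; apply: eU; split => // i j; rewrite ord1 -ball_normE /=.
apply: le_lt_trans yx; rewrite distrC.
by have := coord_le_enorm (y - x) j; rewrite !mxE.
Qed.

(** The grid serves twice: it bounds the number of unit vectors at mutual
    distance at least 1, and it provides finite nets of bounded sets. *)
Lemma finite_cells (K delta : R) : 0 < K -> 0 < delta ->
  exists (I : finType) (cell : 'rV[R]_d -> I), forall x y,
    (forall i, `|x 0 i| <= K) -> (forall i, `|y 0 i| <= K) ->
    cell x = cell y -> enorm (x - y) < delta.
Proof.
move=> K0 delta0.
(* The mesh is [1 / N], where [d / N ^ 2 <= d / N < delta ^ 2]. *)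
pose N := (Num.trunc (d%:R / delta ^+ 2)).+1.
have N0 : 0 < N%:R :> R by rewrite ltr0n.
pose L := Num.trunc (2 * K * N%:R).
exists {ffun 'I_d -> 'I_L.+1},
  (fun x => [ffun i => inord (Num.trunc ((x 0 i + K) * N%:R))]).
move=> x y xK yK /ffunP cxy.
have ci i : `|(x - y) 0 i| < N%:R^-1.
  have := cxy i; rewrite !ffunE => /(congr1 (@nat_of_ord _)).
  have bnd (z : 'rV[R]_d) : `|z 0 i| <= K ->
      0 <= (z 0 i + K) * N%:R /\ (Num.trunc ((z 0 i + K) * N%:R)%R < L.+1)%N.
    rewrite ler_norml => /andP[z1 z2]; split.
      by rewrite mulr_ge0//; lra.
    by rewrite ltnS le_truncn// ler_wpM2r//; lra.
  have [x0 xL] := bnd _ (xK i); have [y0 yL] := bnd _ (yK i).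
  rewrite !inordK// => txy.
  have /andP[x1 x2] := truncn_itv x0; have /andP[y1 y2] := truncn_itv y0.
  rewrite txy in x1 x2.
  rewrite !mxE -(@ltr_pM2r _ N%:R)// mulVf ?gt_eqF// -(gtr0_norm N0) -normrM.
  by rewrite ltr_norml; move: x1 x2 y1 y2; rewrite -natr1; lra.
have : dot (x - y) (x - y) < delta ^+ 2.
  apply: (@le_lt_trans _ _ (d%:R / N%:R)).
    rewrite /dot -[d in leRHS]card_ord -sum1_card natr_sum mulr_suml.
    apply: ler_sum => i _; rewrite mul1r -expr2 -real_normK ?num_real//.
    rewrite -[leRHS]mulr1 expr2 ler_pM//; first exact: ltW.
    by apply/ltW/(lt_le_trans (ci i)); rewrite invf_le1// ler1n.
  rewrite ltr_pdivrMr// mulrC -ltr_pdivrMr ?exprn_gt0//.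
  exact: truncnS_gt.
by rewrite -enorm_sqr ltr_pXn2r// nnegrE ?enorm_ge0 ?ltW.
Qed.

End euclidean_norm.

(** * Greedy selection of balls and bounded overlap *)

Section covering.
Context {R : realType} {d : nat}.
Local Notation E := 'rV[R]_d.

Definition spread_out (I : finType) (J : {set I}) (x : I -> E) (r : I -> R) :=
  {in J &, forall i j, i != j -> r i <= enorm (x i - x j)}.

(** Take a ball of largest radius, discard all the centers inside it, and repeat
    with the remaining centers. *)
Lemma greedy_selection (I : finType) (S : {set I}) (x : I -> E) (r : I -> R) :
  (forall i, i \in S -> 0 < r i) ->
  exists J : {set I}, [/\ J \subset S, spread_out J x r &
    forall i, i \in S -> exists j,
      [/\ j \in J, r i <= r j & enorm (x i - x j) < r j]].
Proof.
have [n] := ubnP #|S|; elim: n S => // n IH S; rewrite ltnS => Sn r0.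
have [->|/finset.set0Pn[i0 i0S]] := eqVneq S finset.set0.
  by exists finset.set0; split => [|i j|i]; rewrite ?inE.
have [j] := @arg_maxP _ _ _ i0 (mem S) r i0S => jS0 jmax; have jS : j \in S := jS0.
pose S' := [set i in S | r j <= enorm (x i - x j)].
have jS' : j \notin S'.
  by rewrite inE subrr enorm0 leNgt r0// andbF.
have S'S : S' \subset S by apply/fintype.subsetP => i; rewrite inE => /andP[].
have S'n : (#|S'| < n)%N.
  apply: leq_trans Sn; apply: proper_card; apply/fintype.properP; split => //.
  by exists j.
have r'0 i : i \in S' -> 0 < r i by move=> /(fintype.subsetP S'S)/r0.
have [J [JS' Jsep Jcov]] := IH S' S'n r'0.
exists (j |: J); split.
- by rewrite finset.subUset finset.sub1set jS (fintype.subset_trans JS').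
- have far i : i \in J -> r j <= enorm (x i - x j).
    by move=> /(fintype.subsetP JS'); rewrite inE => /andP[].
  have rmax i : i \in J -> r i <= r j.
    by move=> /(fintype.subsetP JS')/(fintype.subsetP S'S)/jmax.
  move=> i k; rewrite !inE => /predU1P[->|iJ] /predU1P[->|kJ]; first by rewrite eqxx.
  + by rewrite enorm_distC => _; exact: far.
  + by move=> _; apply: le_trans (far _ iJ); exact: rmax.
  + exact: Jsep.
- move=> i iS; have [far|near] := leP (r j) (enorm (x i - x j)).
    have /Jcov[k [kJ rik xik]] : i \in S' by rewrite inE iS.
    by exists k; rewrite !inE kJ orbT.
  by exists j; rewrite !inE eqxx; split => //; exact: jmax.
Qed.

(** Seen from a common point [y] of two selected balls, their centers are
    farther apart than either of them is from [y], so [wide_angle] applies: the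
    directions from [y] to the centers lie in different cells of a fixed grid. *)
Lemma bounded_overlap : exists C : nat, forall (I : finType) (J : {set I})
    (x : I -> E) (r : I -> R), spread_out J x r -> forall y,
  (#|[set j in J | (enorm (y - x j) < r j)%R]| <= C)%N.
Proof.
have [cells [cell cellP]] := @finite_cells R d 1 1 ltr01 ltr01.
exists #|cells| => I J x r sep y; set A := [set j in J | _].
pose z j := x j - y.
pose v j := (enorm (z j))^-1 *: z j.
suff /card_in_imset <- : {in A &, injective (cell \o v)} by exact: max_card.
have zr j : j \in A -> enorm (z j) < r j.
  by rewrite inE => /andP[_]; rewrite enorm_distC.
have far j k : j \in A -> k \in A -> j != k -> enorm (z k) < enorm (z j - z k).
  move=> jA kA jk; apply: (lt_le_trans (zr _ kA)).
  rewrite enorm_distC /z opprB addrA subrK.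
  by apply: sep; [move: kA|move: jA|rewrite eq_sym]; rewrite // inE => /andP[].
move=> j k jA kA /= cjk; apply/eqP; apply: contraT => jk.
have zjk := far _ _ jA kA jk.
have := far _ _ kA jA; rewrite eq_sym enorm_distC => /(_ jk) zkj.
have zj0 : z j != 0.
  by apply: contraTneq zjk => ->; rewrite sub0r enormN ltxx.
have zk0 : z k != 0.
  by apply: contraTneq zkj => ->; rewrite subr0 ltxx.
have vle i : z i != 0 -> forall l, `|v i 0 l| <= 1.
  move=> zi0 l; apply: (le_trans (coord_le_enorm _ _)).
  rewrite enorm_Z ?invr_ge0 ?enorm_ge0// mulVf ?lexx//.
  by apply: contra_neq zi0 => /enorm_eq0.
have := cellP _ _ (vle _ zj0) (vle _ zk0) cjk.
by rewrite ltNge wide_angle.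
Qed.

End covering.

(** * A weak type estimate for centered balls *)

Section weak_type.
Context {R : realType} {d : nat}.
Local Notation E := 'rV[R]_d.

(** One point of [A] per grid cell of size [delta] is kept. Balls selected
    greedily among those around the kept points cover all the kept points, so
    that their enlargements by [delta] cover [A]; their overlap bounds the sum of
    the values of [mu] on the balls themselves. *)
Lemma weak_type_uniform : exists C : nat,
  forall (m mu : {measure set E -> \bar R}) (A : set E) (K delta lambda : R),
  0 < delta -> 0 <= lambda -> (forall x, A x -> forall i, `|x 0 i| <= K) ->
  (forall x, A x -> exists2 r, 0 < r &
    (lambda%:E * m (eball x (r + delta)) <= mu (eball x r))%E) ->
  exists U, [/\ measurable U, A `<=` U &
    (lambda%:E * m U <= C%:R%:E * mu setT)%E].
Proof.
have [C overlap] := @bounded_overlap R d.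
exists C => m mu A K delta lambda delta0 lambda0 AK Ar.
have [cells [cell cellP]] : exists (I : finType) (cell : E -> I),
    forall x y, A x -> A y -> cell x = cell y -> enorm (x - y) < delta.
  have K0 : 0 < Num.max K 1 by rewrite lt_max ltr01 orbT.
  have [I [cell cellP]] := @finite_cells R d _ _ K0 delta0.
  exists I, cell => x y Ax Ay; apply: cellP => i.
    by rewrite le_max AK.
  by rewrite le_max AK.
pose good c (p : E * R) := [/\ A p.1, cell p.1 = c, 0 < p.2 &
  (lambda%:E * m (eball p.1 (p.2 + delta)) <= mu (eball p.1 p.2))%E].
pose p c := some_or (0, 0) (good c).
pose S : {set cells} := finset (fun c => `[< exists p, good c p >]).
have pS c : c \in S -> good c (p c).
  rewrite inE => /asboolP h; rewrite /p /some_or; case: pselect => // h'.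
  exact: projT2 (cid h').
have [|J [JS Jsep Jcov]] := @greedy_selection _ _ _ S (fst \o p) (snd \o p).
  by move=> c /pS[].
pose B c := eball (p c).1 ((p c).2 + delta).
have BJ c : c \in J -> B c `<=` \big[setU/set0]_(c in J) B c.
  by move=> cJ; rewrite (bigD1 c)//=; exact: subsetUl.
have [mBJ leBJ] : measurable (\big[setU/set0]_(c in J) B c) /\
    (m (\big[setU/set0]_(c in J) B c) <= \sum_(c in J) m (B c))%E.
  pose P X (s : \bar R) := measurable X /\ (m X <= s)%E.
  apply: (big_ind2 P).
  - by rewrite /P measure0.
  - move=> X s Y s' [mX Xs] [mY Ys]; split; first exact: measurableU.
    exact: le_trans (measureU2 _ mX mY) (leeD Xs Ys).
  - by move=> c _; split => //; exact: measurable_eball.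
exists (\big[setU/set0]_(c in J) B c); split => //.
- move=> x Ax; have xS : cell x \in S.
    rewrite inE; apply/asboolP; have [r r0 mr] := Ar _ Ax.
    by exists (x, r).
  have [Ap cp p0 _] := pS _ xS.
  have [c [cJ rc xc]] := Jcov _ xS.
  apply: (BJ c cJ); rewrite /B /eball/=.
  rewrite -[x](subrK (p (cell x)).1) -addrA addrC.
  apply: (le_lt_trans (enormD _ _)); rewrite ltrD//.
  exact: cellP.
apply: (@le_trans _ _ (\sum_(c in J) (lambda%:E * m (B c)))%E).
  by rewrite -ge0_sume_distrr// lee_wpmul2l.
apply: (@le_trans _ _ (\sum_(c in J) mu (eball (p c).1 (p c).2))%E).
  apply: lee_sum => c cJ.
  by have [] := pS c (fintype.subsetP JS _ cJ).
under eq_bigr => c _.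
  rewrite -[X in mu X]setIT -integral_indic//; last exact: measurable_eball.
  over.
rewrite -big_filter -ge0_integral_sum//; last first.
  by move=> c; apply/measurable_EFinP; apply: measurable_indic; exact: measurable_eball.
rewrite -integral_cst//; apply: ge0_le_integral => //.
- by move=> x _; apply: sume_ge0 => c _; rewrite lee_fin.
- apply: emeasurable_sum => c.
  by apply/measurable_EFinP; apply: measurable_indic; exact: measurable_eball.
- move=> x _; rewrite big_filter sumEFin lee_fin/=.
  apply: le_trans (_ : #|[set j in J | enorm (x - (p j).1) < (p j).2]|%:R <= _).
    rewrite -sum1_card natr_sum [leRHS]big_mkcond/= [leLHS]big_mkcond/=.
    apply: ler_sum => c _; rewrite inE; case: (c \in J) => //=.
    rewrite indicE; case: ifPn => [_|xc]; first by case: (_ \in _).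
    by rewrite memNset//; exact/negP.
  by rewrite ler_nat; exact: (overlap _ J (fst \o p) (snd \o p)).
Qed.

(** For [mu] of the form [f m] this is the weak (1,1) estimate for the centered
    maximal function of [f] with respect to [m], with a constant that depends on
    the dimension only. The gap between [r] and [s] is what
    [weak_type_uniform] needs; [A] is exhausted by bounded sets on which the gap
    is uniform. *)
Lemma weak_type : exists C : nat,
  forall (m mu : {measure set E -> \bar R}) (A : set E) (lambda : R),
  0 <= lambda ->
  (forall x, A x -> exists r s, [/\ 0 < r, r < s &
    (lambda%:E * m (eball x s) <= mu (eball x r))%E]) ->
  exists G, [/\ measurable G, A `<=` G &
    (lambda%:E * m G <= C%:R%:E * mu setT)%E].
Proof.
have [C unif] := weak_type_uniform; exists C => m mu A lambda lambda0 Ar.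
pose An n := [set x : E | (forall i, `|x 0 i| <= n.+1%:R) /\
  exists2 r, 0 < r &
    (lambda%:E * m (eball x (r + n.+1%:R^-1)) <= mu (eball x r))%E].
have /choice[U UP] n : exists U, [/\ measurable U, An n `<=` U &
    (lambda%:E * m U <= C%:R%:E * mu setT)%E].
  apply: (unif m mu (An n) n.+1%:R n.+1%:R^-1) => //.
  - by move=> x [].
  - by move=> x [].
(* The covers [U n] need not be monotone, but [An] is, so each point of [A] is
   in all of them from some index on. *)
pose G n := \bigcap_(k in [set k | (n <= k)%N]) U k.
have mG n : measurable (G n).
  by apply: bigcap_measurable => [|k _]; [exists n => /=|have [] := UP k].
have AG : A `<=` \bigcup_n G n.
  move=> x Ax; have [r [s [r0 rs mr]]] := Ar _ Ax.
  have sr0 : 0 < s - r by rewrite subr_gt0.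
  pose n := maxn (Num.trunc (s - r)^-1) (Num.trunc (enorm x)).
  exists n => // k /= nk; have [_ AnU _] := UP k; apply: AnU; split.
    move=> i; apply: (le_trans (coord_le_enorm _ _)).
    apply/ltW/(lt_le_trans (truncnS_gt _)).
    by rewrite ler_nat ltnS (leq_trans _ nk)// leq_maxr.
  exists r => //; apply: le_trans mr; rewrite lee_wpmul2l// le_measure ?inE//;
    [exact: measurable_eball..|].
  move=> y; rewrite /eball/= => /lt_le_trans; apply.
  rewrite -lerBrDl -[leRHS]invrK lef_pV2 ?posrE ?invr_gt0//.
  apply/ltW/(lt_le_trans (truncnS_gt _)).
  by rewrite ler_nat ltnS (leq_trans _ nk)// leq_maxl.
exists (\bigcup_n G n); split => //; first exact: bigcupT_measurable.
have ndG : nondecreasing_seq G.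
  by move=> n k nk; apply/subsetPset => x Gx j /= kj; apply: Gx => /=; exact: leq_trans kj.
have cvgG := nondecreasing_cvg_mu mG (bigcupT_measurable _ mG) ndG.
have cvglG := cvgeZl (isT : lambda%:E \is a fin_num) (cvgG R m).
apply: (cvge_to_le cvglG).
near=> n => /=; have [mU _ ] := UP n; apply: le_trans.
rewrite lee_wpmul2l// le_measure ?inE//.
by move=> x; apply => /=.
Unshelve. all: by end_near. Qed.

End weak_type.

(** * Boxes and outer regularity *)

Section boxes.
Context {R : realType} {d : nat}.
Local Notation E := 'rV[R]_d.
Implicit Types a b x : E.

Definition obox a b : set E := [set x | forall i, a 0 i < x 0 i < b 0 i].
Definition cbox a b : set E := [set x | forall i, a 0 i <= x 0 i <= b 0 i].

Lemma continuous_coord (i : 'I_d) : continuous (fun x : E => x 0 i).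
Proof. exact: coord_continuous. Qed.

Lemma open_obox a b : open (obox a b).
Proof.
rewrite openE => x xab.
have h (i : 'I_d) : nbhs x [set y : E | a 0 i < y 0 i < b 0 i].
  have /andP[ax xb] := xab i.
  have ox : nbhs (x 0 i) `]a 0 i, b 0 i[%classic.
    by apply: near_in_itvoo; rewrite in_itv/= ax.
  apply: (@filterS _ (nbhs x) _ _ _ _ (@continuous_coord i x _ ox)) => y.
  by rewrite /= in_itv.
exact: (@filter_forall _ _ (fun i (y : E) => a 0 i < y 0 i < b 0 i) (nbhs x) _ h).
Qed.

Lemma compact_cbox a b : compact (cbox a b).
Proof.
have := @rV_compact R d (fun i => `[a 0 i, b 0 i]%classic)
  (fun i => @segment_compact R (a 0 i) (b 0 i)).
by congr compact; apply/seteqP; split => x /= xab i; have := xab i; rewrite /= in_itv.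
Qed.

Lemma closed_cbox a b : closed (cbox a b).
Proof. exact: (compact_closed (@norm_hausdorff _ _) (@compact_cbox a b)). Qed.

Lemma measurable_obox a b : measurable (obox a b).
Proof. by apply: open_measurable_rV; exact: open_obox. Qed.

Lemma oboxI a b a' b' : obox a b `&` obox a' b' =
  obox (\row_i Num.max (a 0 i) (a' 0 i)) (\row_i Num.min (b 0 i) (b' 0 i)).
Proof.
apply/seteqP; split => x /=.
  move=> [xab xab'] i; have := xab i; have := xab' i.
  by rewrite !mxE gt_max lt_min => /andP[-> ->] /andP[-> ->].
move=> h; split => i; have := h i; rewrite !mxE gt_max lt_min.
  by move=> /andP[/andP[-> _] /andP[-> _]].
by move=> /andP[/andP[_ ->] /andP[_ ->]].
Qed.

Definition boxes : set (set E) := [set B | exists a b, B = obox a b].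

Lemma setI_closed_boxes : setI_closed boxes.
Proof. by move=> _ _ [a [b ->]] [a' [b' ->]]; rewrite oboxI; do 2 eexists. Qed.

Lemma measurable_boxesE : @measurable _ E = <<s boxes >>.
Proof.
apply/seteqP; split => A; last first.
  apply: smallest_sub; first exact: sigma_algebra_measurable.
  by move=> _ [a [b ->]]; exact: measurable_obox.
move=> mA.
have mid : measurable_fun setT (idfun : g_sigma_algebraType boxes -> E).
  apply: measurable_fun_rV => i.
  move=> mT; apply: (measurability _ (RGenOInfty.measurableE R)) => // _ [_ [r ->] <-].
  rewrite setTI.
  pose a n : E := \row_j (if j == i then r else - n%:R).
  pose b n : E := \row_j n%:R.
  rewrite (_ : _ @^-1` _ = \bigcup_n obox (a n) (b n)).
    apply: bigcupT_measurable => n; apply: sub_sigma_algebra.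
    by exists (a n), (b n).
  apply/seteqP; split => x /=.
    rewrite in_itv/= andbT => rx; exists (Num.trunc (enorm (x : E))).+1 => // j.
    have xj := le_lt_trans (coord_le_enorm (x : E) j) (truncnS_gt _).
    move: xj; rewrite ltr_norml => /andP[x1 x2].
    by rewrite !mxE x2 andbT; case: eqP => [->|].
  by move=> [n _ /(_ i)]; rewrite !mxE eqxx in_itv/= andbT => /andP[].
by have := mid measurableT A mA; rewrite setTI.
Qed.

Lemma open_bigcup_boxes (U : set E) : open U -> exists a b : nat -> E,
  U = \bigcup_(k in [set k | cbox (a k) (b k) `<=` U]) obox (a k) (b k).
Proof.
move=> oU.
(* Cubes with rational centers and half-side [1 / (n + 1)]. *)
pose f (k : nat) : 'rV[rat]_d * nat := odflt (0, 0%N) (unpickle k).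
pose c k : E := map_mx ratr (f k).1.
pose e k : E := \row_j (f k).2.+1%:R^-1.
exists (fun k => c k - e k), (fun k => c k + e k).
apply/seteqP; split => [x Ux|x [k /= kU xk]]; last first.
  by apply: kU => i; have /andP[/ltW-> /ltW->] := xk i.
have [r r0 rU] : exists2 r : R, 0 < r & forall y : E, (forall i, `|x 0 i - y 0 i| < r) -> U y.
  have /nbhs_ballP[r /= r0 rU] := open_nbhs_nbhs (conj oU Ux).
  exists r => // y yx; apply: rU; split => // i j.
  by rewrite ord1 -ball_normE /=; exact: yx.
have [n [t [tE t0 tr]]] : exists (n : nat) (t : R),
    [/\ n.+1%:R^-1 = t, 0 < t & t < r / 2].
  exists (Num.trunc (r / 2)^-1), (Num.trunc (r / 2)^-1).+1%:R^-1.
  by rewrite invr_gt0 ltr0n invf_plt ?posrE ?divr_gt0// truncnS_gt.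
have qx i : {q : rat | `|x 0 i - ratr q| < t}.
  apply: cid.
  have [s] := @dense_rat R (ball (x 0 i) t)
    (ex_intro _ (x 0 i) (ballxx _ t0)) (ball_open _ _).
  by case=> + [q _ qs]; rewrite -ball_normE /= -qs => ?; exists q.
pose p : 'rV[rat]_d * nat := (\row_i sval (qx i), n).
have fp : f (pickle p) = p by rewrite /f pickleK.
have xq i : `|x 0 i - c (pickle p) 0 i| < t.
  by rewrite /c fp !mxE; exact: svalP (qx i).
exists (pickle p) => [y yb|i].
  apply: rU => i; have := yb i; have := xq i; rewrite !mxE fp/= tE.
  by rewrite !ltr_norml => /andP[? ?] /andP[? ?]; apply/andP; split; lra.
by have := xq i; rewrite !mxE fp/= tE ltr_norml => /andP[? ?]; apply/andP; split; lra.
Qed.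

End boxes.

Section regularity.
Context {R : realType} {d : nat}.
Local Notation E := 'rV[R]_d.

(** Squeezing a set between an open set and the complement of an open set, up to
    small measure, is symmetric under complements and survives countable unions
    with errors [e / 2 ^ n]; it can be done for boxes. *)
Lemma outer_regular (m : {finite_measure set E -> \bar R}) (B : set E)
    (eps : R) : measurable B -> 0 < eps ->
  exists U, [/\ open U, B `<=` U & (m (U `\` B) < eps%:E)%E].
Proof.
move=> mB.
pose reg (B : set E) := measurable B /\ forall eps : R, 0 < eps -> exists U V,
  [/\ open U, open V, B `<=` U, ~` B `<=` V & (m (U `&` V) < eps%:E)%E].
have fm (A : set E) : measurable A -> (m A < +oo)%E.
  by move=> mA; rewrite ltey_eq fin_num_measure.
suff : reg B.
  move=> [_ h] e0; have [U [V [oU oV BU BV UV]]] := h _ e0.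
  exists U; split => //; apply: le_lt_trans UV.
  have mU := open_measurable_rV oU; have mV := open_measurable_rV oV.
  apply: le_measure; rewrite ?inE; [exact: measurableD|exact: measurableI|].
  by move=> x [Ux /BV].
have : <<s boxes >> B by rewrite -measurable_boxesE.
(* Continuity from above: a countable intersection of open sets is replaced by
   a finite one, which is still open. *)
have small (F : nat -> set E) (e : R) : (forall n, open (F n)) ->
    nonincreasing_seq F -> (m (\bigcap_n F n) < e%:E)%E -> 
    exists n, (m (F n) < e%:E)%E.
  move=> oF ndF mFe.
  have mF n := open_measurable_rV (oF n).
  have cF := nonincreasing_cvg_mu (fm _ (mF 0%N)) mF (bigcapT_measurable mF) ndF.
  apply: contrapT => /forallNP nF; move: mFe; rewrite ltNge => /negP; apply.
  apply: (cvge_to_ge cF); near=> n; rewrite leNgt; apply/negP; exact: nF.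

apply: smallest_sub; last first.
  move=> _ [a [b ->]]; split; first exact: measurable_obox.
  move=> e e0.
  have [t [t0 tle tsmall]] : exists t : nat -> R, [/\ forall n, 0 < t n,
      forall k n, (n <= k)%N -> t k <= t n &
      forall s, 0 < s -> exists n, t n <= s].
    exists (fun n => n.+1%:R^-1); split => [n|k n nk|s s0].
    - by rewrite invr_gt0.
    - by rewrite lef_pV2 ?posrE ?ltr0n// ler_nat.
    - by exists (Num.trunc s^-1); rewrite ltW// invf_plt ?posrE// truncnS_gt.
  pose core n : set E := cbox (\row_i (a 0 i + t n)) (\row_i (b 0 i - t n)).
  pose F n : set E := obox a b `&` ~` core n.
  have oC n : open (~` core n) by apply: closed_openC; exact: closed_cbox.
  have oF n : open (F n) by apply: openI; [exact: open_obox|exact: oC].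
  have [||n Fn] := small F e oF.
  - move=> k n kn; apply/subsetPset => x [xab xn]; split => // xk; apply: xn => i.
    have := xk i; rewrite !mxE => /andP[? ?]; have := tle _ _ kn => ?.
    by apply/andP; split; lra.
  - rewrite (_ : \bigcap_n F n = set0) ?measure0 ?lte_fin//.
    apply/seteqP; split => // x xF.
    have [xab _] := xF 0%N Logic.I.
    have /choice[N NP] i : exists n, a 0 i + t n <= x 0 i <= b 0 i - t n.
      have /andP[ax xb] := xab i.
      have [|n tn] := tsmall (Num.min (x 0 i - a 0 i) (b 0 i - x 0 i)).
        by rewrite lt_min !subr_gt0 ax.
      by exists n; move: tn; rewrite le_min => /andP[? ?]; apply/andP; split; lra.
    have [_] := xF (\max_i N i)%N Logic.I; apply => i.
    have ? := tle _ _ (leq_bigmax i : N i <= \max_i N i)%N.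
    by have := NP i; rewrite !mxE => /andP[? ?]; apply/andP; split; lra.
  exists (obox a b), (~` core n); split => //; first exact: open_obox.
  apply: subsetC => x xn i; have := t0 n.
  by have := xn i; rewrite !mxE => /andP[? ?] ?; apply/andP; split; lra.
split.
- split => [|e e0]; first exact: measurable0.
  exists set0, setT; split=> //; last by rewrite set0I measure0 lte_fin.
  by apply: openT.
- move=> A [mA regA]; split; first by rewrite setTD; exact: measurableC.
  move=> e /regA[U [V [oU oV AU AV UV]]]; exists V, U; split => //.
  + by rewrite setTD.
  + by rewrite setTD setCK.
  + by rewrite setIC.
- move=> A regA; split; first by apply: bigcupT_measurable => n; have [] := regA n.
  move=> e e0; have e20 : 0 < e / 2 by rewrite divr_gt0.
  have /choice[UV UVP] n : exists UV : set E * set E,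
      [/\ open UV.1, open UV.2, A n `<=` UV.1, ~` A n `<=` UV.2 &
      (m (UV.1 `&` UV.2) < (e / 2 / 2 / (2 ^ n.+1)%:R)%:E)%E].
    have [_ /(_ (e / 2 / 2 / (2 ^ n.+1)%:R))[|U [V h]]] := regA n.
      by rewrite !divr_gt0// ltr0n expn_gt0.
    by exists (U, V).
  pose U := \bigcup_n (UV n).1.
  pose V N := \bigcap_(n < N) (UV n).2.
  have oU : open U by apply: bigcup_open => n _; have [] := UVP n.
  have oV N : open (V N).
    rewrite /V bigcap_mkord; apply: (big_ind open) => [||i _].
    - exact: openT.
    - exact: openI.
    - by have [] := UVP i.
  have [|||N UVN] := small (fun N => U `&` V N) e.
  - by move=> N; exact: openI.
  - by move=> k n kn; apply/subsetPset => x [Ux Vx]; split => // i /= ik;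
      apply: Vx; exact: leq_trans kn.
  - apply: (@le_lt_trans _ _ (e / 2)%:E); last by rewrite lte_fin; lra.
    apply: (@le_trans _ _ (\sum_(0 <= n <oo) m ((UV n).1 `&` (UV n).2))%E).
      apply: measure_sigma_subadditive.
      + by move=> n; apply: open_measurable_rV; have [? ? _ _ _] := UVP n; exact: openI.
      + by apply: bigcapT_measurable => n; apply: open_measurable_rV; exact: openI.
      + move=> x xUV; have [[n _ xn] _] := xUV 0%N Logic.I.
        exists n => //; split => //.
        by have [_ /(_ n)] := xUV n.+1 Logic.I; apply => /=.
    apply: le_trans (epsilon_trick0 predT (ltW e20)).
    apply: lee_nneseries => n _ //.
    have [_ _ _ _ /ltW/le_trans] := UVP n; apply; rewrite lee_fin.
    by rewrite ler_wpM2r// ler_pdivrMr//; lra.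
  exists U, (V N); split => //.
  - by move=> x [n _ Anx]; exists n => //; have [_ _ + _ _] := UVP n; exact.
  - move=> x /= nAx n /= nN; have [_ _ _ + _] := UVP n; apply => Anx.
    by apply: nAx; exists n.
Unshelve. all: by end_near. Qed.

End regularity.

(** * Differentiation of finite measures *)

Section small_covers.
Context d (T : measurableType d) (R : realType).

Lemma negligible_small_covers (m : {measure set T -> \bar R}) (A : set T) :
  (forall e : R, 0 < e -> exists G, [/\ measurable G, A `<=` G & (m G <= e%:E)%E]) ->
  m.-negligible A.
Proof.
move=> cov.
have /choice[G GP] n : exists G, [/\ measurable G, A `<=` G & (m G <= n.+1%:R^-1%:E)%E].
  by apply: cov; rewrite invr_gt0.
have mG : measurable (\bigcap_n G n).
  by apply: bigcapT_measurable => n; have [] := GP n.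
exists (\bigcap_n G n); split => //; last first.
  by move=> x Ax n _; have [_ + _] := GP n; exact.
apply/eqP; rewrite -measure_le0; apply/lee_addgt0Pr => e e0; rewrite add0e.
have [_ _ mGn] := GP (Num.trunc e^-1).
apply: (@le_trans _ _ (m (G (Num.trunc e^-1)))).
  apply: le_measure; rewrite ?inE//; first by have [] := GP (Num.trunc e^-1).
  by move=> x; apply.
apply: le_trans mGn _; rewrite lee_fin ltW// invf_plt ?posrE//.
exact: truncnS_gt.
Qed.

Lemma integrable_ae_bounded (m : {measure set T -> \bar R}) (D : set T)
    (f : T -> R) (M : R) : measurable D -> (m D < +oo)%E -> measurable_fun D f ->
  {ae m, forall x, D x -> `|f x| <= M} -> m.-integrable D (EFin \o f).
Proof.
move=> mD Doo mf fM; apply/integrableP; split; first exact/measurable_EFinP.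
have M0 : (0 <= (Num.max M 0)%:E)%E by rewrite lee_fin le_max lexx orbT.
apply: (@le_lt_trans _ _ ((Num.max M 0)%:E * m D)%E); last first.
  by rewrite ltey_eq fin_numM// ge0_fin_numE.
apply: integral_le_bound => //; first exact/measurable_EFinP.
by apply: filterS fM => x h Dx; rewrite lee_fin le_max h.
Qed.

End small_covers.

Section differentiation.
Context {R : realType} {d : nat}.
Local Notation E := 'rV[R]_d.
Variable m : {finite_measure set E -> \bar R}.

(** Points that have a ball of measure zero satisfy the hypothesis of the weak
    type estimate with [mu = 0]. *)
Lemma ae_ball_pos : {ae m, forall x, forall r : R, 0 < r -> (0 < m (eball x r))%E}.
Proof.
have [C wt] := @weak_type R d.
have [|x /existsNP[r /not_implyP[r0 /negP]]|G [mG AG mG0]] := wt m mzero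
    (~` [set x | forall r : R, 0 < r -> (0 < m (eball x r))%E]) 1.
- by [].
- rewrite -leNgt => mx; exists (r / 2), r; split; first by rewrite divr_gt0.
    by rewrite ltr_pdivrMr// ltr_pMr// ltr1n.
  by rewrite mul1e.
- exists G; split => //; apply/eqP; rewrite eq_le measure_ge0 andbT.
  by move: mG0; rewrite mul1e mule0.
Qed.

(** This produces the gap between radii that [weak_type] asks for. *)
Lemma shrink_ball (mu : {measure set E -> \bar R}) x (r : R) (c : \bar R) :
  0 < r -> (c < mu (eball x r))%E -> exists s, [/\ 0 < s, s < r & (c <= mu (eball x s))%E].
Proof.
move=> r0 cmu.
(* [n + 2] keeps these radii positive. *)
pose s n := r - r / n.+2%:R.
have sr n : s n < r by rewrite /s ltrBlDr ltrDl divr_gt0.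
have s0 n : 0 < s n.
  by rewrite /s subr_gt0 ltr_pdivrMr// ltr_pMr// ltr1n.
have mB n : measurable (eball x (s n)) by exact: measurable_eball.
have ndB : nondecreasing_seq (fun n => eball x (s n)).
  move=> n k nk; apply/subsetPset => y; rewrite /eball/= => /lt_le_trans; apply.
  by rewrite /s lerD2l lerN2 ler_wpM2l ?(ltW r0)// lef_pV2 ?posrE ?ltr0n// ler_nat.
have Br : eball x r = \bigcup_n eball x (s n).
  apply/seteqP; split => y; last first.
    by move=> [n _]; rewrite /eball/= => /lt_trans; exact.
  rewrite /eball/= => yr.
  exists (Num.trunc (r / (r - enorm (y - x)))) => //=.
  rewrite /s ltrBrDr -ltrBrDl ltr_pdivrMr// mulrC -ltr_pdivrMr ?subr_gt0//.
  by apply: (lt_trans (truncnS_gt _)); rewrite ltr_nat.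
apply: contrapT => /forallNP nc; move: cmu; rewrite ltNge => /negP; apply.
rewrite Br; have cB := nondecreasing_cvg_mu mB (bigcupT_measurable _ mB) ndB.
apply: (cvge_to_le (cB _ mu)); near=> n.
rewrite leNgt; apply/negP => h; apply: (nc (s n)); split => //; exact: ltW.
Unshelve. all: by end_near. Qed.

(** Let [U] be open, containing [B], with [m (U \ B)] small. For [x] in [B] small
    balls stay inside [U], so where the density of the complement of [B] is not
    small, the maximal function of the restriction of [m] to [U \ B] is not
    small either. The weak type estimate bounds the measure of these points. *)
Lemma density (B : set E) : measurable B ->
  {ae m, forall x, B x -> forall e : R, 0 < e ->
    \forall r \near 0^'+, (m (eball x r `\` B) <= e%:E * m (eball x r))%E}.
Proof.
move=> mB.
have dens (e : R) : 0 < e -> {ae m, forall x, B x ->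
    \forall r \near 0^'+, (m (eball x r `\` B) <= e%:E * m (eball x r))%E}.
  move=> e0; apply: negligible_small_covers => del del0.
  have [C wt] := @weak_type R d.
  have [|U [oU BU mU]] := outer_regular m mB (_ : 0 < del * e / C.+1%:R).
    by rewrite divr_gt0// mulr_gt0.
  have mUB : measurable (U `\` B).
    by apply: measurableD => //; exact: open_measurable_rV.
  pose mu := mrestr m mUB.
  have [|x /not_implyP[Bx nx]|G [mG AG mG0]] := wt m mu
      (~` [set x | B x -> \forall r \near 0^'+,
        (m (eball x r `\` B) <= e%:E * m (eball x r))%E]) e.
  - exact: ltW.
  - have [r0 r00 rU] := open_eball oU (BU _ Bx).
    have [r [r1 rr0 mr]] : exists r, [/\ 0 < r, r < r0 &
        (e%:E * m (eball x r) < m (eball x r `\` B))%E].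
      apply: contrapT => /forallNP nr; apply: nx.
      near=> r; rewrite leNgt; apply/negP => h; apply: (nr r); split => //.
    have muE : mu (eball x r) = m (eball x r `\` B).
      rewrite /mu/= /mrestr; congr (m _); apply/seteqP; split => y; first by move=> [? []].
      move=> [yr nBy]; split => //; split => //; apply: rU.
      by move: yr; rewrite /eball/= => /lt_trans; exact.
    have [|s [s0 sr hs]] := @shrink_ball mu x r (e%:E * m (eball x r))%E r1.
      by move: mr; rewrite -muE.
    by exists s, r.
  exists G; split => //.
  rewrite -(@lee_pmul2l _ e%:E)//.
  apply: (le_trans mG0); rewrite /mu/= /mrestr setTI.
  apply: (@le_trans _ _ (C%:R%:E * (del * e / C.+1%:R)%:E)%E).
    by rewrite lee_wpmul2l// ltW.
  rewrite -!EFinM lee_fin.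
  rewrite mulrA ler_pdivrMr// mulrC (mulrC e) ler_wpM2l ?ler_nat//.
  by rewrite mulr_ge0// ltW.
have : {ae m, forall x, forall n, B x -> \forall r \near 0^'+,
    (m (eball x r `\` B) <= n.+1%:R^-1%:E * m (eball x r))%E}.
  by apply: ae_foralln => n; apply: dens; rewrite invr_gt0.
apply: filterS => x h Bx e e0.
apply: filterS (h (Num.trunc e^-1) Bx) => r /le_trans; apply.
rewrite lee_wpmul2r// lee_fin ltW// invf_plt ?posrE//.
exact: truncnS_gt.
Unshelve. all: by end_near. Qed.

(** Almost every [x] is a density point of all the sets [p < f < q] with
    rational [p], [q] that contain it; on such a set [f] differs from [f x] by at
    most [q - p]; the complement takes a small part of a small ball, on which
    the bound [M] suffices. *)
Theorem lebesgue_besicovitch (f : E -> R) (M : R) :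
  measurable_fun setT f -> {ae m, forall x, `|f x| <= M} ->
  {ae m, forall x, (fine (m (eball x r)))^-1 * \int[m]_(y in eball x r) f y
    @[r --> 0^'+] --> f x}.
Proof.
move=> mf fM.
have mpre p q : measurable (f @^-1` `]p, q[).
  by rewrite -[X in measurable X]setTI; exact: mf.
have : {ae m, forall x, forall n, forall p q : rat, unpickle n = Some (p, q) ->
    (f @^-1` `]ratr p, ratr q[) x -> forall e : R, 0 < e -> \forall r \near 0^'+,
    (m (eball x r `\` f @^-1` `]ratr p, ratr q[) <= e%:E * m (eball x r))%E}.
  apply: ae_foralln => n; case: (unpickle n) => [[p q]|]; last first.
    by apply: aeW.
  apply: filterS (density (mpre (ratr p) (ratr q))) => x h p' q' [<- <-].
  exact: h.
apply: filterS3 (fM) ae_ball_pos => x fxM posx dx.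
have M0 : 0 <= M by apply: le_trans fxM.
apply/cvgrPdist_le => e e0.
(* In a ball that meets the complement of the level set in a fraction at most
   [e'], the average of [|f - f x|] is at most [e' + 2 M e']. *)
pose e' := e / (1 + 2 * M).
have M1 : 0 < 1 + 2 * M by rewrite ltr_wpDr// mulr_ge0.
have e'0 : 0 < e' by rewrite divr_gt0.
have [p pq1 pq2] : exists2 p : rat, f x - e' / 2 < ratr p & ratr p < f x.
  have [|p /=] := @rat_in_itvoo R (f x - e' / 2) (f x).
    by rewrite ltrBlDr ltrDl divr_gt0.
  by rewrite in_itv/= => /andP[? ?]; exists p.
have [q q1 q2] : exists2 q : rat, f x < ratr q & ratr q < f x + e' / 2.
  have [|q /=] := @rat_in_itvoo R (f x) (f x + e' / 2).
    by rewrite ltrDl divr_gt0.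
  by rewrite in_itv/= => /andP[? ?]; exists q.
have Bx : (f @^-1` `]ratr p, ratr q[) x by rewrite /= in_itv/= pq2.
have dens := dx (pickle (p, q)) p q (pickleK _) Bx e' e'0.
near=> r.
have r0 : 0 < r by near: r; exact: nbhs_right_gt.
have mBrB : (m (eball x r `\` f @^-1` `]ratr p, ratr q[) <=
    e'%:E * m (eball x r))%E by near: r.
have := posx r r0; set Br := eball x r in mBrB * => mBr0.
have mBr : measurable Br by exact: measurable_eball.
have fmBr : m Br \is a fin_num by rewrite fin_num_measure.
have fBr0 : 0 < fine (m Br) by rewrite fine_gt0// mBr0 ltey_eq fmBr.
have intf : m.-integrable Br (EFin \o f).
  apply: (@integrable_ae_bounded _ _ _ _ _ _ M) => //.
  - by rewrite ltey_eq fmBr.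
  - exact: measurable_funTS.
  - by apply: filterS fM => y.
have intc : m.-integrable Br (EFin \o cst (f x)).
  exact: finite_measure_integrable_cst.
have intB : m.-integrable Br (EFin \o (fun y => f x - f y)).
  exact: (integrableB mBr intc intf).
rewrite -[f x in X in X <= _](mulKf (lt0r_neq0 fBr0)) -mulrBr normrM.
rewrite (gtr0_norm (_ : 0 < (fine _)^-1)) ?invr_gt0// mulrC ler_pdivrMr//.
rewrite mulrC -Rintegral_cst// -RintegralB//.
apply: (le_trans (le_normr_Rintegral mBr intB)).
have mB := mpre (ratr p) (ratr q); set B := f @^-1` _ in mB mBrB Bx *.
have mBB : measurable (Br `\` B) by exact: measurableD.
rewrite -lee_fin /Rintegral fineK; last first.
  by apply: integrable_fin_num => //; exact: (integrable_norm intB).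
apply: (@le_trans _ _ (\int[m]_(y in Br) (e' + 2 * M * \1_(Br `\` B) y)%:E)%E).
  apply: ae_ge0_le_integral => //.
  - apply/measurable_EFinP; apply: measurableT_comp => //.
    by apply: measurable_funB => //; exact: measurable_funTS.
  - by move=> y _; rewrite lee_fin addr_ge0 ?(ltW e'0)// !mulr_ge0.
  - apply/measurable_EFinP; apply: measurable_funD => //.
    by apply: measurable_funM => //; exact: measurable_indic.
  - apply: filterS fM => y fyM yBr; rewrite lee_fin.
    rewrite indicE; case: (boolP (y \in _)) => [_|yB].
      rewrite mulr1; apply: (le_trans (ler_normB _ _)).
      by move: fxM fyM; lra.
    have yB' : B y by apply: contrapT => nBy; move/negP: yB; apply; rewrite inE.
    move: yB'; rewrite /B/= in_itv/= => /andP[py qy].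
    by rewrite mulr0 addr0 ler_norml; apply/andP; split; lra.
under eq_integral do rewrite EFinD.
rewrite ge0_integralD//=; last 3 first.
  - by move=> y _; rewrite lee_fin ltW.
  - by move=> y _; rewrite lee_fin !mulr_ge0.
  - by apply/measurable_EFinP; apply: measurable_funM => //; exact: measurable_indic.
rewrite integral_cst//.
under [X in (_ + X)%E]eq_integral do rewrite EFinM.
rewrite ge0_integralZl//=; last 2 first.
  - by apply/measurable_EFinP; exact: measurable_indic.
  - by rewrite lee_fin !mulr_ge0.
rewrite integral_indic// setIC setIidr//.
apply: (@le_trans _ _ (e'%:E * m Br + (2 * M)%:E * (e'%:E * m Br))%E).
  by rewrite leeD2l// lee_wpmul2l// lee_fin mulr_ge0.
rewrite -(fineK fmBr) -!EFinM -EFinD lee_fin.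
rewrite mulrA -mulrDl ler_wpM2r ?(ltW fBr0)//.
by rewrite -[X in X + _]mul1r -mulrDl mulrC /e' divfK// lt0r_neq0.
Unshelve. all: by end_near. Qed.

End differentiation.

(** * Smooth cut-off functions of boxes *)

Section C1_functions.
Context {R : realType} {d : nat}.
Local Notation E := 'rV[R]_d.
Implicit Types f g : E -> R.

Lemma Ck1P f : continuous f ->
  (forall i, exists2 df : E -> R, continuous df &
    forall x, is_derive x (basis_vec i) f (df x)) -> Ck 1 f.
Proof.
move=> cf hf; split=> // i; have [df cdf fdf] := hf i; split.
  by move=> x; exact: @ex_derive _ _ _ _ _ _ _ (fdf x).
rewrite (_ : partial i f = df)//.
by apply/funext => x; exact: @derive_val _ _ _ _ _ _ _ (fdf x).
Qed.

Lemma Ck1_is_derive f i x : Ck 1 f -> is_derive x (basis_vec i) f (partial i f x).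
Proof. by move=> [_ /(_ i)[df _]]; apply: DeriveDef. Qed.

Lemma Ck1_cst (a : R) : Ck 1 (fun _ : E => a).
Proof.
apply: Ck1P => [|i]; first exact: cst_continuous.
exists (fun=> 0) => [|x]; first exact: cst_continuous.
exact: is_derive_cst.
Qed.

Lemma Ck1M f g : Ck 1 f -> Ck 1 g -> Ck 1 (fun x => f x * g x).
Proof.
move=> hf hg; have [cf pf] := hf; have [cg pg] := hg.
apply: Ck1P => [x|i]; first exact: continuousM (cf x) (cg x).
exists (fun x => f x * partial i g x + g x * partial i f x).
  move=> x; have [_ [+ _]] := pf i => /(_ x) ?; have [_ [+ _]] := pg i => /(_ x) ?.
  apply: (@continuousD _ _ _ (fun y => f y * partial i g y)
    (fun y => g y * partial i f y)).
    exact: continuousM (cf x) _.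
  exact: continuousM (cg x) _.
move=> x; exact: (is_deriveM (Ck1_is_derive i x hf) (Ck1_is_derive i x hg)).
Qed.

Lemma Ck1_prod (I : finType) (f : I -> E -> R) : (forall i, Ck 1 (f i)) ->
  Ck 1 (fun x => \prod_i f i x).
Proof.
move=> hf.
rewrite (_ : (fun x => _) = \big[(fun f g x => f x * g x)/(fun=> 1)]_i f i).
  by apply: (big_ind (Ck 1)) => [|g h|i _]; [exact: Ck1_cst|exact: Ck1M|].
apply/funext => x.
by apply: (big_ind2 (fun s (g : E -> R) => s = g x)) => [//|? g ? h -> ->|].
Qed.

Lemma Ck1V f : (forall x, f x != 0) -> Ck 1 f -> Ck 1 (fun x => (f x)^-1).
Proof.
move=> f0 hf; have [cf pf] := hf.
have cV : continuous (fun x => (f x)^-1).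
  by move=> x; exact: continuousV (f0 x) (cf x).
apply: Ck1P => // i.
exists (fun x => - ((f x)^-1 * (f x)^-1) * partial i f x).
  move=> x; have [_ [+ _]] := pf i => /(_ x) cp.
  apply: (@continuousM _ _ (fun x => - ((f x)^-1 * (f x)^-1))) => //.
  apply: (@continuousN _ _ _ (fun x => ((f x)^-1 * (f x)^-1))).
  exact: continuousM (cV x) (cV x).
move=> x; have [df _] := pf i; apply: DeriveDef.
  exact: (derivableV (f0 x) (df x)).
rewrite (deriveV (f0 x) (df x)).
by rewrite /GRing.scale/= -exprVn expr2.
Qed.

Lemma Ck1B f g : Ck 1 f -> Ck 1 g -> Ck 1 (fun x => f x - g x).
Proof.
move=> hf hg; have [cf pf] := hf; have [cg pg] := hg.
apply: Ck1P => [x|i]; first exact: continuousB (cf x) (cg x).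
exists (fun x => partial i f x - partial i g x).
  move=> x; have [_ [+ _]] := pf i => /(_ x) ?; have [_ [+ _]] := pg i => /(_ x) ?.
  exact: (@continuousB _ _ _ (partial i f) (partial i g)).
move=> x; exact: (is_deriveB (Ck1_is_derive i x hf) (Ck1_is_derive i x hg)).
Qed.

(** In contrast with the positive part itself, its square is [C^1]. *)
Definition sqpos (t : R) : R := Num.max t 0 ^+ 2.

(** A bound that is uniform in [s] avoids a case distinction at the kink when
    the derivative is computed. *)
Lemma sqpos_taylor (s h : R) :
  `|sqpos (s + h) - sqpos s - 2 * h * Num.max s 0| <= h ^+ 2.
Proof.
have hh := sqr_ge0 h; have hs := sqr_ge0 s; have hhs := sqr_ge0 (s + h).
rewrite /sqpos.
case: (leP s 0) => s0; case: (leP (s + h) 0) => sh0.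
- by rewrite expr0n/= !subr0 mulr0 subr0 normr0.
- rewrite expr0n/= mulr0 !subr0 ger0_norm//.
  by rewrite ler_pXn2r ?nnegrE//; lra.
- have p1 : 0 <= - (s + h) * (s - h) by rewrite mulr_ge0//; lra.
  have p2 : 0 <= s * - (s + h) by rewrite mulr_ge0//; lra.
  by rewrite expr0n/= ler_norml; apply/andP; split; lra.
- rewrite (_ : _ - _ - _ = h ^+ 2); last by ring.
  by rewrite ger0_norm.
Qed.

Lemma Ck1_sqpos_coord (a b : R) (j : 'I_d) : Ck 1 (fun x => sqpos (a * x 0 j + b)).
Proof.
have cmax : continuous (fun x : E => Num.max (a * x 0 j + b) 0).
  move=> x; have caff : {for x, continuous (fun y : E => a * y 0 j + b)}.
    apply: (@continuousD _ _ _ (fun y : E => a * y 0 j) (cst b)); last exact: cst_continuous.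
    apply: (@continuousM _ _ (cst a) (fun y : E => y 0 j)); first exact: cst_continuous.
    exact: continuous_coord.
  exact: (@continuous_max _ _ _ (fun=> 0) x caff (@cst_continuous _ _ _ x)).
apply: Ck1P => [x|i].
  exact: (continuousM (cmax x) (cmax x)).
exists (fun x => 2 * (a * (i == j)%:R) * Num.max (a * x 0 j + b) 0).
  move=> x; exact: (@continuousM _ _ (cst (2 * (a * (i == j)%:R)))
    (fun y : E => Num.max (a * y 0 j + b) 0) x (@cst_continuous _ _ _ x) (cmax x)).
move=> x; set D := (X in is_derive _ _ _ X).
suff h : (h^-1 *: (((fun x : E => sqpos (a * x 0 j + b)) \o shift x)
   (h *: basis_vec i) - sqpos (a * x 0 j + b))) @[h --> 0^'] --> D.
  by apply: DeriveDef; [apply/cvg_ex; exists D|exact/cvg_lim].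
apply/cvgrPdist_le => e e0.
have e1 : 0 < e / (1 + a ^+ 2) by rewrite divr_gt0// ltr_wpDr// sqr_ge0.
near=> h.
have h0 : h != 0 by near: h; exact: nbhs_dnbhs_neq.
have hn0 : 0 < `|h| by rewrite normr_gt0.
have he : `|h| < e / (1 + a ^+ 2) by near: h; exact: dnbhs0_lt.
pose del := a * (i == j)%:R * h.
pose y : E := h *: basis_vec i + x.
have := sqpos_taylor (a * x 0 j + b) del.
have -> : a * x 0 j + b + del = a * y 0 j + b.
  by rewrite !mxE eqxx/= eq_sym /del; ring.
change (`|sqpos (a * y 0 j + b) - sqpos (a * x 0 j + b)
    - 2 * del * Num.max (a * x 0 j + b) 0| <= del ^+ 2 ->
  `|D - h^-1 * (sqpos (a * y 0 j + b) - sqpos (a * x 0 j + b))| <= e).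
set G := sqpos (a * y 0 j + b); set g := sqpos _ => taylor.
rewrite distrC.
rewrite (_ : _ - D = h^-1 * (G - g - 2 * del * Num.max (a * x 0 j + b) 0)); last first.
  by rewrite /D /del; field.
rewrite normrM normfV ler_pdivrMl//; apply: (le_trans taylor).
apply: (@le_trans _ _ (a ^+ 2 * `|h| ^+ 2)).
  rewrite /del exprMn real_normK ?num_real// ler_wpM2r ?sqr_ge0// exprMn.
  by rewrite ler_piMr ?sqr_ge0//; case: (i == j); rewrite ?expr1n ?expr0n.
rewrite (expr2 `|h|) mulrA (mulrC _ `|h|) ler_wpM2l//.
move: he; rewrite ltr_pdivlMr ?ltr_wpDr ?sqr_ge0// => he.
by have := ltW hn0; lra.
Unshelve. all: by end_near. Qed.

End C1_functions.

Section bumps.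
Context {R : realType} {d : nat}.
Local Notation E := 'rV[R]_d.

Lemma continuous_measurable_rV (f : E -> R) : continuous f -> measurable_fun setT f.
Proof.
move=> /continuousP cf mT.
apply: (measurability _ (RGenOpens.measurableE R)) => // _ [_ [u [v ->]] <-].
by rewrite setTI; apply: open_measurable_rV; apply: cf; exact: interval_open.
Qed.

Lemma sqpos_eq0 (t : R) : (sqpos t == 0) = (t <= 0).
Proof.
by rewrite /sqpos sqrf_eq0; case: (leP t 0) => [|t0]; rewrite ?eqxx// gt_eqF.
Qed.

(** A product [p] of functions [sqpos] of affine functions is positive exactly on
    the open box, and [1 - 1 / (1 + k p)] increases to the indicator of
    the set where [p] is positive. *)
Lemma box_bumps (a b : E) : exists phi : nat -> E -> R,
  [/\ forall k, Ck 1 (phi k), forall k x, ~ cbox a b x -> phi k x = 0,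
      forall k x, 0 <= phi k x <= 1 &
      forall x, phi k x @[k --> \oo] --> (\1_(obox a b) x : R)].
Proof.
pose p (x : E) := \prod_i (sqpos (1 * x 0 i + - a 0 i) * sqpos (-1 * x 0 i + b 0 i)).
have p0 x : 0 <= p x.
  by apply: prodr_ge0 => i _; rewrite mulr_ge0 ?sqr_ge0.
have pE x : (p x == 0) = ~~ (x \in obox a b).
  apply/idP/idP => [/prodf_eq0[i _]|nx].
    rewrite mulf_eq0 !sqpos_eq0 => h; apply/negP; rewrite inE => /(_ i)/andP[? ?].
    by move: h => /orP[|]; lra.
  have /existsNP[i /negP] : ~ obox a b x by move: nx => /negP; rewrite inE.
  rewrite negb_and -!leNgt => h; rewrite /p (bigD1 i)//= mulf_eq0; apply/orP; left.
  rewrite mulf_eq0 !sqpos_eq0; move: h => /orP[? | ?]; apply/orP; [left|right]; lra.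
have q0 k x : 0 < 1 + k%:R * p x by rewrite ltr_wpDr// mulr_ge0.
exists (fun k x => 1 - (1 + k%:R * p x)^-1); split => [k|k x nx|k x|x].
- apply: (@Ck1B _ _ (fun=> 1)); first exact: Ck1_cst.
  apply: Ck1V => [x|]; first by rewrite gt_eqF.
  rewrite (_ : (fun x => _) = (fun x => 1 - (- k%:R * p x))); last first.
    by apply/funext => x; rewrite mulNr opprK.
  apply: (@Ck1B _ _ (fun=> 1)); first exact: Ck1_cst.
  apply: (@Ck1M _ _ (fun=> - k%:R)); first exact: Ck1_cst.
  by apply: Ck1_prod => i; apply: Ck1M; exact: Ck1_sqpos_coord.
- have -> : p x = 0.
    apply/eqP; rewrite pE; apply/negP; rewrite inE => xab; apply: nx => i.
    by have /andP[/ltW-> /ltW->] := xab i.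
  by rewrite mulr0 addr0 invr1 subrr.
- by rewrite subr_ge0 invf_le1 ?q0// lerDl mulr_ge0//= lerBlDr lerDl invr_ge0 ltW.
- rewrite indicE; have := pE x; case: (boolP (x \in _)) => /= _ px.
    have {}px : 0 < p x by rewrite lt0r px p0.
    rewrite -[X in _ --> X]subr0; apply: cvgB; first exact: cvg_cst.
    apply/cvgrPdist_le => e e0; near=> k; rewrite sub0r normrN gtr0_norm ?invr_gt0//.
    have ke : (e * p x)^-1 <= k%:R by near: k; exact: nbhs_infty_ger.
    rewrite invf_ple ?posrE//; move: ke; rewrite invfM ler_pdivrMr// => ke.
    by rewrite (le_trans ke)// lerDr.
  have -> : p x = 0 by exact/eqP.
  by under eq_fun do rewrite mulr0 addr0 invr1 subrr; exact: cvg_cst.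
Unshelve. all: by end_near. Qed.

(** The sets whose part in a given box has charge zero form a lambda-system that
    contains all the boxes. An open set is a countable union of boxes that it
    contains together with their faces, and these can be made disjoint. *)
Lemma charge_eq0_open (Omega : set E) (c : {charge set E -> \bar R}) :
  open Omega -> (forall a b, cbox a b `<=` Omega -> c (obox a b) = 0%E) ->
  forall B, measurable B -> B `<=` Omega -> c B = 0%E.
Proof.
move=> oO c0.
have cU (F : nat -> set E) : (forall n, measurable (F n)) -> trivIset setT F ->
    (forall n, c (F n) = 0%E) -> c (\bigcup_n F n) = 0%E.
  move=> mF tF cF.
  have := @charge_semi_sigma_additive _ _ _ c F mF tF (bigcupT_measurable _ mF).
  under eq_fun do rewrite big1//.
  by move=> /cvg_unique; apply => //; exact: cvg_cst.
have cbox0 a b : cbox a b `<=` Omega -> forall B, measurable B -> c (B `&` obox a b) = 0%E.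
  move=> abO; pose H := [set B : set E | measurable B /\ c (B `&` obox a b) = 0%E].
  suff : measurable `<=` H by move=> h B /h[].
  rewrite measurable_boxesE; apply: lambda_system_subset => //.
  - exact: setI_closed_boxes.
  - apply/dynkin_lambda_system; split.
    + by split => //; rewrite setTI c0.
    + move=> B [mB cB]; split; first exact: measurableC.
      have := chargeDI c (measurable_obox a b) mB.
      by rewrite c0// setIC cB adde0 setDE setIC.
    + move=> F tF HF; split; first by apply: bigcupT_measurable => n; have [] := HF n.
      rewrite setI_bigcupl; apply: cU.
      * by move=> n; apply: measurableI; [have [] := HF n|exact: measurable_obox].
      * exact: trivIset_setIr.
      * by move=> n; have [] := HF n.
  - move=> _ [a' [b' ->]]; split; first exact: measurable_obox.
    rewrite oboxI; apply: c0; apply: subset_trans abO => x xab i.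
    by have := xab i; rewrite !mxE ge_max le_min => /andP[/andP[_ ->] /andP[_ ->]].
move=> B mB BO.
have [a [b Oab]] := open_bigcup_boxes oO.
pose Q k := if pselect (cbox (a k) (b k) `<=` Omega) is left _ then obox (a k) (b k) else set0.
have mQ k : measurable (Q k).
  by rewrite /Q; case: pselect => // _; exact: measurable_obox.
have BQ : B = \bigcup_k (B `&` seqDU Q k).
  rewrite -setI_bigcupr -seqDU_bigcup_eq; apply/esym/setIidPl => x /BO.
  rewrite {1}Oab => -[k /= kO xk]; exists k => //.
  by rewrite /Q; case: pselect.
have mS k : measurable (seqDU Q k) by exact: seqDU_measurable.
rewrite BQ; apply: cU.
- by move=> n; exact: measurableI.
- by apply: trivIset_setIl; exact: trivIset_seqDU.
- move=> n.
  have -> : B `&` seqDU Q n = (B `&` seqDU Q n) `&` Q n.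
    by apply/esym/setIidPl => x [_]; exact: subset_seqDU.
  have mBS : measurable (B `&` seqDU Q n) by exact: measurableI.
  rewrite {2}/Q; case: pselect => [h|_]; last by rewrite setI0 charge0.
  exact: cbox0.
Qed.

End bumps.

(** * Barycenters of a disintegrated varifold *)

Section ae_integral.
Context d (T : measurableType d) (R : realType).
Variable mu : {measure set T -> \bar R}.
Local Open Scope ereal_scope.

Lemma ge0_integral_mono (f g : T -> \bar R) : (forall x, 0 <= f x) ->
  (forall x, f x <= g x) -> \int[mu]_x f x <= \int[mu]_x g x.
Proof.
move=> f0 fg; have g0 x : 0 <= g x by exact: le_trans (f0 x) (fg x).
rewrite !ge0_integralTE//; apply: ge_ereal_sup => _ [h hf <-].
apply: ereal_sup_ubound; exists h => //= x; exact: le_trans (hf x) (fg x).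
Qed.

(** Only one of the two functions is assumed to be measurable, because fiber
    integrals of a disintegration are only known to be almost everywhere equal
    to a measurable function. The other one is squeezed between two
    measurable functions. *)
Lemma ge0_ae_eq_integralT (f g : T -> \bar R) : (forall x, 0 <= f x) ->
  (forall x, 0 <= g x) -> measurable_fun setT g -> {ae mu, forall x, f x = g x} ->
  \int[mu]_x f x = \int[mu]_x g x.
Proof.
move=> f0 g0 mg [N [mN N0 fgN]].
have fg x : ~ N x -> f x = g x.
  by move=> nNx; apply: contrapT => h; apply: nNx; exact: fgN.
have mNC : measurable (~` N) by exact: measurableC.
pose lo := g \_ (~` N); pose hi := fun x => lo x + ((cst +oo) \_ N) x.
have mlo : measurable_fun setT lo.
  by apply/(measurable_restrictT _ mNC); exact: measurable_funTS.
have mhi : measurable_fun setT hi.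
  by apply: emeasurable_funD => //; apply/(measurable_restrictT _ mN).
have lo0 x : 0 <= lo x by exact: erestrict_ge0.
have hi0 x : 0 <= hi x by apply: adde_ge0 => //; apply: erestrict_ge0 => y _; exact: leey.
have ae_lo : ae_eq mu setT g lo.
  exists N; split => // x /= /not_implyP[_ h]; apply: contrapT => nNx; apply: h.
  by rewrite /lo patchE mem_set.
have ae_hi : ae_eq mu setT g hi.
  exists N; split => // x /= /not_implyP[_ h]; apply: contrapT => nNx; apply: h.
  by rewrite /hi /lo !patchE mem_set// memNset// adde0.
apply/eqP; rewrite eq_le; apply/andP; split.
  rewrite (ge0_ae_eq_integral _ mg mhi)//; apply: ge0_integral_mono => // x.
  rewrite /hi /lo !patchE in_setC; have [xN|xN] /= := boolP (x \in N).
    by rewrite add0e leey.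
  by rewrite adde0 fg// => Nx; move/negP: xN; apply; rewrite inE.
rewrite (ge0_ae_eq_integral _ mg mlo)//; apply: ge0_integral_mono => // x.
rewrite /lo patchE in_setC; have [//|xN] /= := boolP (x \in N).
by rewrite fg// => Nx; move/negP: xN; apply; rewrite inE.
Qed.

End ae_integral.

Section barycenters.
Context {R : realType} {d : nat}.
Local Notation E := 'rV[R]_d.
Implicit Types P : {measure set E -> \bar R}.

Lemma sphere_coord_le1 (s : E) i : sphere s -> `|s 0 i| <= 1.
Proof. by move=> <-; exact: coord_le_enorm. Qed.

Lemma probability_on_sphere_setT P : probability_on_sphere P -> P setT = 1%E.
Proof.
move=> [P1 PC]; have mS := @measurable_sphere R d.
rewrite -(setUv sphere) measureU ?setICr//; last exact: measurableC.
by rewrite [X in (X + _)%E]P1 [X in (_ + X)%E]PC adde0.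
Qed.

Lemma measurable_dot (c : E) : measurable_fun setT (fun s : E => dot c s).
Proof.
rewrite /dot; apply: measurable_sum => i; apply: measurable_funM => //.
exact: measurable_coord.
Qed.

Lemma integrable_sphere P (f : E -> R) (M : R) : probability_on_sphere P ->
  measurable_fun setT f -> (forall s, sphere s -> `|f s| <= M) ->
  P.-integrable sphere (EFin \o f).
Proof.
move=> [P1 _] mf fM; apply: (@integrable_ae_bounded _ _ _ _ _ _ M) => //.
- exact: measurable_sphere.
- by rewrite P1 ltry.
- exact: measurable_funTS.
- exact: aeW.
Qed.

Lemma dot_barycenter P (c : E) : probability_on_sphere P ->
  dot c (barycenter P) = \int[P]_(s in sphere) dot c s.
Proof.
move=> PS.
have intc i : P.-integrable sphere (EFin \o (fun s : E => s 0 i)).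
  by apply: (integrable_sphere PS (measurable_coord i)) => s /sphere_coord_le1.
have intZ i : P.-integrable sphere (EFin \o (fun s : E => c 0 i * s 0 i)).
  apply: (integrable_sphere PS (M := `|c 0 i|)) => [|s /sphere_coord_le1 si].
    by apply: measurable_funM => //; exact: measurable_coord.
  by rewrite normrM ler_piMr.
have -> : (\int[P]_(s in sphere) dot c s) =
    \sum_i \int[P]_(s in sphere) (c 0 i * s 0 i).
  rewrite /Rintegral /dot; under eq_integral do rewrite -sumEFin.
  rewrite integral_sum//; last exact: measurable_sphere.
  rewrite sum_fine// => i _; apply: integrable_fin_num; first exact: measurable_sphere.
  exact: intZ.
apply: eq_bigr => i _; rewrite mxE RintegralZl//; exact: measurable_sphere.
Qed.

(** Test with [b] itself: the average of [dot b s] over unit vectors [s] is at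
    most the norm of [b]. *)
Lemma enorm_barycenter_le1 P : probability_on_sphere P -> enorm (barycenter P) <= 1.
Proof.
move=> PS; set b := barycenter P.
have [b0|b0] := eqVneq (enorm b) 0; first by rewrite b0.
have bpos : 0 < enorm b by rewrite lt0r b0 enorm_ge0.
rewrite -(ler_pM2l bpos) mulr1 -expr2 enorm_sqr dot_barycenter//.
have [P1 _] := PS.
apply: (@le_trans _ _ (\int[P]_(s in sphere) (enorm b))).
  apply: le_Rintegral => //.
  - exact: measurable_sphere.
  - apply: (integrable_sphere PS (measurable_dot b) (M := enorm b)) => s s1.
    by apply: (le_trans (norm_dot_le_enorm _ _)); rewrite s1 mulr1.
  - by apply: (integrable_sphere PS (M := `|enorm b|)).
  - by move=> s s1; apply: (le_trans (dot_le_enorm _ _)); rewrite s1 mulr1.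
rewrite Rintegral_cst; last exact: measurable_sphere.
by rewrite -[X in fine X]/(P sphere) P1 mulr1.
Qed.

(** Equality in the Cauchy-Schwarz inequality: if the average of unit vectors
    is a unit vector [b], then [1 - dot b s >= 0] has integral zero, so almost
    all of them are equal to [b]. *)
Lemma unit_barycenter_dirac P : probability_on_sphere P ->
  enorm (barycenter P) = 1 -> forall B, measurable B -> P B = \d_(barycenter P) B.
Proof.
move=> PS; set b := barycenter P => b1.
have [P1 PC] := PS.
have mS := @measurable_sphere R d.
have sb s : sphere s -> dot b s <= 1.
  by move=> s1; apply: (le_trans (dot_le_enorm _ _)); rewrite b1 s1 mulr1.
have intb : P.-integrable sphere (EFin \o (fun s : E => dot b s)).
  apply: (integrable_sphere PS (M := 1) (measurable_dot b)) => s s1.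
  by apply: (le_trans (norm_dot_le_enorm _ _)); rewrite b1 s1 mulr1.
have int1 : P.-integrable sphere (EFin \o (fun s : E => 1)).
  by apply: (integrable_sphere PS (M := 1)) => // s _; rewrite normr1.
have int0 : (\int[P]_(s in sphere) `|(1 - dot b s)%:E| = 0)%E.
  transitivity (\int[P]_(s in sphere) (1 - dot b s)%:E)%E.
    apply: eq_integral => s; rewrite inE => /sb bs1.
    by rewrite gee0_abs// lee_fin subr_ge0.
  transitivity (\int[P]_(s in sphere) (1 - dot b s))%:E.
    rewrite /Rintegral fineK//; apply: integrable_fin_num => //.
    exact: (integrableB mS int1 intb).
  rewrite RintegralB// -dot_barycenter// -/b Rintegral_cst//.
  by rewrite [X in fine X]P1 -enorm_sqr b1 mulr1 expr1n subrr.
have m1 : measurable_fun sphere (fun s : E => (1 - dot b s)%:E).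
  apply/measurable_EFinP; apply: measurable_funB => //; apply: measurable_funTS.
  exact: measurable_dot.
have /(ae_eq_integral_abs _ mS m1)[N [mN N0 bN]] := int0.
have NP (s : E) : ~ N s -> sphere s -> s = b.
  move=> nNs s1; have h : 1 - dot b s = 0.
    apply: contrapT => h; apply: nNs; apply: bN => /= /(_ s1)[]; exact: h.
  apply/eqP; rewrite -subr_eq0; apply/eqP/enorm_eq0/eqP.
  rewrite -sqrf_eq0 enormB_sqr b1 s1 dotC; apply/eqP; lra.
have null B : measurable B -> ~ B b -> P B = 0%E.
  move=> mB nBb; apply/eqP; rewrite -measure_le0.
  apply: (@le_trans _ _ (P (N `|` ~` sphere))).
    apply: le_measure; rewrite ?inE//; first by apply: measurableU => //; exact: measurableC.
    move=> s Bs; have [Ns|nNs] := pselect (N s); [by left|right => s1].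
    by apply: nBb; rewrite -(NP s nNs s1).
  have mSC : measurable (~` (@sphere R d)) by exact: measurableC.
  apply: (le_trans (measureU2 P mN mSC)).
  by rewrite [X in (X + _)%E]N0 [X in (_ + X)%E]PC adde0.
move=> B mB; rewrite diracE; case: (boolP (b \in B)) => [|] bB; last first.
  by apply: null => //; move: bB; rewrite notin_setE.
rewrite inE in bB.
have PT := probability_on_sphere_setT PS.
have PBC : P (~` B) = 0%E by apply: null => //; exact: measurableC.
rewrite -PT -(setUv B) measureU ?setICr//; last exact: measurableC.
by rewrite [X in (_ + X)%E]PBC adde0.
Qed.

Section representative.
Variables (V : {measure set (E * E)%type -> \bar R}) (om : E -> {measure set E -> \bar R}).
Hypotheses (Vfin : (V setT < +oo)%E) (Vom : disintegrates V (mass V) om)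
  (omS : {ae mass V, forall x, probability_on_sphere (om x)}).

(** Replaces the fiber integrals of [g] by a function that is measurable and
    bounded everywhere, so that the usual integration theory applies to it. *)
Lemma disintegrates_mean (g : E -> R) : measurable_fun setT g ->
  (forall s, 0 <= g s <= 1) -> exists G : E -> R,
  [/\ measurable_fun setT G, forall x, 0 <= G x <= 1,
      {ae mass V, forall x, (\int[om x]_s (g s)%:E = (G x)%:E)%E} &
      forall phi : E -> R, measurable_fun setT phi -> (forall x, 0 <= phi x) ->
        (\int[V]_p (phi p.1 * g p.2)%:E = \int[mass V]_x (phi x * G x)%:E)%E].
Proof.
move=> mg g01; have g0 s : 0 <= g s by case/andP: (g01 s).
have mg2 : measurable_fun setT (fun p : E * E => g p.2).
  exact: measurableT_comp mg measurable_snd.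
have mgE : measurable_fun setT (fun p : E * E => (g p.2)%:E) by exact/measurable_EFinP.
have [[G0 [mG0 G0E]] _] := Vom mgE (fun p => g0 p.2).
pose G x := Num.max 0 (Num.min 1 (fine (G0 x))).
have mG : measurable_fun setT G.
  apply: measurable_maxr => //; apply: measurable_minr => //.
  exact: measurableT_comp (fine_measurable _) mG0.
have G01 x : 0 <= G x <= 1 by rewrite /G le_max lexx ge_max ler01 ge_min lexx.
have GE : {ae mass V, forall x, (\int[om x]_s (g s)%:E = (G x)%:E)%E}.
  apply: filterS2 omS G0E => x Px /(_ Logic.I) GE.
  have p0 : (0 <= G0 x)%E by rewrite -GE integral_ge0// => s _; rewrite lee_fin.
  have p1 : (G0 x <= 1)%E.
    rewrite -GE -(probability_on_sphere_setT Px) -[leRHS]mul1e.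
    rewrite -(integral_cst (om x) measurableT 1%E).
    apply: ge0_le_integral => //.
    - by move=> s _; rewrite lee_fin.
    - exact/measurable_EFinP.
    - by move=> s _; rewrite lee_fin; case/andP: (g01 s).
  have fG0 : G0 x \is a fin_num.
    by rewrite ge0_fin_numE// (le_lt_trans p1)// ltry.
  rewrite GE /G min_r ?max_r ?fineK//; first exact: fine_ge0.
  by rewrite -lee_fin fineK.
exists G; split => // phi mphi phi0.
have mpg : measurable_fun setT (fun p : E * E => (phi p.1 * g p.2)%:E).
  apply/measurable_EFinP; apply: measurable_funM => //.
  exact: measurableT_comp mphi measurable_fst.
have [_ ->] := Vom mpg (fun p => mulr_ge0 (phi0 p.1) (g0 p.2)).
apply: ge0_ae_eq_integralT => [x|x||].
- by apply: integral_ge0 => s _; rewrite lee_fin mulr_ge0.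
- by rewrite lee_fin mulr_ge0//; case/andP: (G01 x).
- by apply/measurable_EFinP; exact: measurable_funM.
- apply: filterS GE => x GxE /=.
  under eq_integral do rewrite EFinM.
  rewrite ge0_integralZl//=; first by rewrite GxE EFinM.
  - exact/measurable_EFinP.
  - by move=> s _; rewrite lee_fin.
  - by rewrite lee_fin.
Qed.

(** The coordinates change sign, while disintegration speaks of nonnegative
    functions, so their positive and negative parts on the sphere are treated
    separately. *)
Lemma barycenter_representative (U : set E) : measurable U ->
  V (~` (U `*` sphere)) = 0%E -> exists beta : E -> E,
  [/\ forall i, measurable_fun setT (fun x => beta x 0 i),
      forall x i, `|beta x 0 i| <= 1,
      {ae mass V, forall x, barycenter (om x) = beta x} &
      forall (phi : E -> R) (i : 'I_d), measurable_fun setT phi ->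
        (forall x, 0 <= phi x <= 1) ->
        \int[V]_(p in U `*` sphere) (phi p.1 * p.2 0 i) =
        \int[mass V]_x (phi x * beta x 0 i)].
Proof.
move=> mU VU; have mS := @measurable_sphere R d.
pose part (sg : R) i (s : E) := Num.max (sg * s 0 i) 0 * \1_sphere s : R.
have mpart sg i : measurable_fun setT (part sg i).
  apply: measurable_funM; last exact: measurable_indic.
  apply: measurable_maxr => //; apply: measurable_funM => //; exact: measurable_coord.
have part01 sg i s : `|sg| <= 1 -> 0 <= part sg i s <= 1.
  move=> sg1; rewrite /part indicE; case: (boolP (s \in _)) => [|_]; last first.
    by rewrite mulr0 lexx ler01.
  rewrite inE mulr1 le_max lexx orbT ge_max ler01 andbT => /sphere_coord_le1 => /(_ i) si.
  by apply: (le_trans (ler_norm _)); rewrite normrM mulr_ile1.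
have partB i s : part 1 i s - part (-1) i s = s 0 i * \1_sphere s.
  rewrite /part -mulrBl mul1r mulN1r; congr (_ * _).
  by case: (leP (s 0 i) 0) => ?; case: (leP (- s 0 i) 0) => ?; lra.
have n1 : `|1 : R| <= 1 by rewrite normr1.
have n1' : `|-1 : R| <= 1 by rewrite normrN1.
have /choice[Gp GpP] i := disintegrates_mean (mpart 1 i)
  (fun s => part01 1 i s n1).
have /choice[Gn GnP] i := disintegrates_mean (mpart (-1) i)
  (fun s => part01 (-1) i s n1').
exists (fun x => \row_i (Gp i x - Gn i x)); split.
- move=> i; under eq_fun do rewrite mxE.
  by apply: measurable_funB; [have [] := GpP i|have [] := GnP i].
- move=> x i; rewrite mxE.
  have [_ /(_ x)/andP[? ?] _ _] := GpP i; have [_ /(_ x)/andP[? ?] _ _] := GnP i.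
  by rewrite ler_norml; apply/andP; split; lra.
- have Gae : {ae mass V, forall x i,
      (\int[om x]_s (part 1 i s)%:E = (Gp i x)%:E)%E /\
      (\int[om x]_s (part (-1) i s)%:E = (Gn i x)%:E)%E}.
    apply: (@filter_forall _ _ (fun i x =>
      (\int[om x]_s (part 1 i s)%:E = (Gp i x)%:E)%E /\
      (\int[om x]_s (part (-1) i s)%:E = (Gn i x)%:E)%E) (almost_everywhere (mass V))).
    move=> i; have [_ _ hp _] := GpP i; have [_ _ hn _] := GnP i.
    by apply: filterS2 hp hn.
  apply: filterS2 omS Gae => x Px Gx; apply/rowP => i; rewrite !mxE.
  have [px nx] := Gx i.
  have intp sg : `|sg| <= 1 -> (om x).-integrable setT (EFin \o part sg i).
    move=> sg1; apply: (@integrable_ae_bounded _ _ _ _ _ _ 1) => //.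
    - by rewrite (probability_on_sphere_setT Px) ltry.
    - by apply: aeW => s _; have /andP[? ?] := part01 sg i s sg1; rewrite ger0_norm.
  rewrite /Rintegral integral_mkcond.
  transitivity (fine (\int[om x]_s ((part 1 i s)%:E - (part (-1) i s)%:E))%E).
    congr fine; apply: eq_integral => s _; rewrite -EFinB partB patchE indicE.
    by case: ifP => _; rewrite ?mulr1 ?mulr0.
  by rewrite integralB//; [rewrite px nx|exact: intp|exact: intp].
- move=> phi i mphi phi01; have phi0 x : 0 <= phi x by case/andP: (phi01 x).
  have mUS : measurable (U `*` @sphere R d) by exact: measurableX.
  pose F sg (p : E * E) := phi p.1 * part sg i p.2.
  have intF sg : `|sg| <= 1 -> V.-integrable setT (EFin \o F sg).
    move=> sg1; apply: (@integrable_ae_bounded _ _ _ _ _ _ 1) => //.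
    - apply: measurable_funM; first exact: measurableT_comp mphi measurable_fst.
      exact: measurableT_comp (mpart sg i) measurable_snd.
    - rewrite /F; apply: aeW => p _; have /andP[? ?] := part01 sg i p.2 sg1.
      have /andP[? ?] := phi01 p.1.
      by rewrite ger0_norm; [exact: mulr_ile1|exact: mulr_ge0].
  have mVoo : (mass V setT < +oo)%E.
    apply: le_lt_trans Vfin; apply: le_measure; rewrite ?inE//.
    exact: measurableX.
  have intG (G : E -> R) : measurable_fun setT G -> (forall x, 0 <= G x <= 1) ->
      (mass V).-integrable setT (EFin \o (fun x => phi x * G x)).
    move=> mG G01; apply: (@integrable_ae_bounded _ _ _ _ _ _ 1) => //.
    - exact: measurable_funM.
    - apply: aeW => x _ /=; have /andP[? ?] := G01 x; have /andP[? ?] := phi01 x.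
      by rewrite ger0_norm; [exact: mulr_ile1|exact: mulr_ge0].
  have [mGp Gp01 _ VGp] := GpP i; have [mGn Gn01 _ VGn] := GnP i.
  transitivity (\int[V]_p (F 1 p - F (-1) p)).
    rewrite /Rintegral; congr fine.
    rewrite [RHS](negligible_integral (N := ~` (U `*` sphere)))//; first last.
    - exact: (integrableB measurableT (intF _ n1) (intF _ n1')).
    - exact: measurableC.
    rewrite setTD setCK; apply: eq_integral => p; rewrite inE => -[_ p2S].
    by rewrite /F -mulrBr partB indicE mem_set// mulr1.
  rewrite RintegralB//; [|exact: intF|exact: intF].
  rewrite /Rintegral /F VGp// VGn//.
  rewrite -[LHS]RintegralB//; [|exact: intG|exact: intG].
  by apply: eq_Rintegral => x _; rewrite mxE mulrBr.
Qed.

End representative.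

End barycenters.

(** * Polar decomposition of a vector measure *)

Section density_functions.
Context d (T : measurableType d) (R : realType).

(** A null set of a measure with density [h] is one where [h] vanishes almost
    everywhere. *)
Lemma ae_density (sigma m : {measure set T -> \bar R}) (h : T -> R) (P : T -> Prop) :
  measurable_fun setT h -> (forall x, 0 <= h x) ->
  (forall B, measurable B -> m B = \int[sigma]_(x in B) (h x)%:E)%E ->
  {ae m, forall x, P x} -> {ae sigma, forall x, h x = 0 \/ P x}.
Proof.
move=> mh h0 mE [N [mN N0 PN]].
have mhN : measurable_fun N (EFin \o h) by apply/measurable_EFinP; exact: measurable_funTS.
have /(ae_eq_integral_abs _ mN mhN) : (\int[sigma]_(x in N) `|(h x)%:E| = 0)%E.
  rewrite -N0 mE//; apply: eq_integral => x _.
  by rewrite gee0_abs// lee_fin.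
apply: filterS => x hx; have [Nx|nNx] := pselect (N x).
  by left; have /= [] := hx Nx.
by right; apply: contrapT => nPx; apply: nNx; exact: PN.
Qed.

End density_functions.

Section vector_measures.
Context {R : realType} {d : nat}.
Local Notation E := 'rV[R]_d.
Variables (Omega : set E) (sigma m : {finite_measure set E -> \bar R}) (beta nu : E -> E).
Hypotheses (oO : open Omega) (mO : m (~` Omega) = 0%E)
  (mbeta : forall i, measurable_fun setT (fun x => beta x 0 i))
  (beta1 : forall x i, `|beta x 0 i| <= 1)
  (mnu : forall i, measurable_fun setT (fun x => nu x 0 i))
  (nu1 : {ae m, forall x, enorm (nu x) = 1})
  (agree : forall (phi : E -> R) i, Ck 1 phi -> supported_in Omega phi ->
     (forall x, 0 <= phi x <= 1) ->
     \int[sigma]_x (phi x * beta x 0 i) = \int[m]_(x in Omega) (phi x * nu x 0 i)).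

Let cvg_weights (mu : {finite_measure set E -> \bar R}) (D B : set E) (f : E -> R)
    (phi : nat -> E -> R) : measurable D -> measurable B -> B `<=` D ->
  measurable_fun setT f -> {ae mu, forall x, `|f x| <= 1} ->
  (forall k, measurable_fun setT (phi k)) -> (forall k x, 0 <= phi k x <= 1) ->
  (forall x, phi k x @[k --> \oo] --> (\1_B x : R)) ->
  \int[mu]_(x in D) (phi k x * f x) @[k --> \oo] --> \int[mu]_(x in B) f x.
Proof.
move=> mD mB BD mf f1 mphi phi01 cphi.
have intone : mu.-integrable D (cst 1%E) by exact: finite_measure_integrable_cst.
have mBD : measurable_fun D (fun x => (\1_B x * f x)%:E).
  by apply/measurable_EFinP; apply: measurable_funTS; apply: measurable_funM.
have mphif k : measurable_fun D (fun x => (phi k x * f x)%:E).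
  by apply/measurable_EFinP; apply: measurable_funTS; apply: measurable_funM.
have cphif : {ae mu, forall x, D x ->
    (phi k x * f x)%:E @[k --> \oo] --> (\1_B x * f x)%:E}.
  apply: aeW => x _; apply: cvg_EFin; first by near=> k.
  by apply: cvgM; [exact: cphi|exact: cvg_cst].
have bphif : {ae mu, forall x k, D x -> (`|(phi k x * f x)%:E| <= cst 1 x)%E}.
  apply: filterS f1 => x fx k _; have /andP[p0 p1] := phi01 k x.
  by rewrite abse_EFin lee_fin normrM (ger0_norm p0); exact: mulr_ile1.
have [ilim _ lim] := dominated_convergence mD mphif mBD cphif intone bphif.
have -> : \int[mu]_(x in B) f x = \int[mu]_(x in D) (\1_B x * f x).
  rewrite /Rintegral; congr fine.
  rewrite -{1}(setIidr BD) integral_mkcondr; apply: eq_integral => x _.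
  by rewrite patchE indicE; case: ifP => _; rewrite ?mul1r ?mul0r.
rewrite /Rintegral; apply: fine_cvg; rewrite fineK//.
exact: integrable_fin_num ilim.
Unshelve. all: by end_near. Qed.

Let nu_le1 i : {ae m, forall x, `|nu x 0 i| <= 1}.
Proof. by apply: filterS nu1 => x <-; exact: coord_le_enorm. Qed.

Let intbeta i : sigma.-integrable setT (fun x => (beta x 0 i)%:E).
Proof.
apply: (@integrable_ae_bounded _ _ _ _ _ _ 1) => //.
- by rewrite ltey_eq fin_num_measure.
- exact: aeW.
Qed.

Let intnu i : m.-integrable setT (fun x => (nu x 0 i)%:E).
Proof.
apply: (@integrable_ae_bounded _ _ _ _ _ _ 1) => //.
- by rewrite ltey_eq fin_num_measure.
- by apply: filterS (nu_le1 i).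
Qed.

(** Bump functions give equality on boxes inside [Omega]; the difference of the
    two sides, seen as a function of [B], is a charge. *)
Lemma vector_measures_agree i B : measurable B -> B `<=` Omega ->
  (\int[sigma]_(x in B) (beta x 0 i)%:E = \int[m]_(x in B) (nu x 0 i)%:E)%E.
Proof.
move=> mB BO; have mOm : measurable Omega by exact: open_measurable_rV.
pose c := cadd (induced_charge (intbeta i)) (cscale (-1) (induced_charge (intnu i))).
have intS (A : set E) : measurable A ->
    (\int[sigma]_(x in A) (beta x 0 i)%:E)%E \is a fin_num.
  by move=> mA; apply: integrable_fin_num => //; exact: integrableS (intbeta i).
have intM (A : set E) : measurable A ->
    (\int[m]_(x in A) (nu x 0 i)%:E)%E \is a fin_num.
  by move=> mA; apply: integrable_fin_num => //; exact: integrableS (intnu i).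
have cE (A : set E) : (c A = \int[sigma]_(x in A) (beta x 0 i)%:E
    - \int[m]_(x in A) (nu x 0 i)%:E)%E.
  by rewrite /c/= /cadd/= /cscale/= /induced_charge EFinN mulN1e.
suff : (c B = 0)%E.
  rewrite cE -(fineK (intS _ mB)) -(fineK (intM _ mB)) -EFinB => -[/eqP].
  by rewrite subr_eq0 => /eqP ->.
apply: (charge_eq0_open oO _ mB BO) => a b abO.
have mab := @measurable_obox R d a b.
have abO' : obox a b `<=` Omega.
  by move=> x xab; apply: abO => j; have /andP[/ltW-> /ltW->] := xab j.
have [phi [Cphi phi0 phi01 cphi]] := box_bumps a b.
have mphi k : measurable_fun setT (phi k).
  by apply: continuous_measurable_rV; have [] := Cphi k.
have := @cvg_weights m Omega (obox a b) _ phi mOm mab abO' (mnu i) (nu_le1 i) mphi phi01 cphi.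
have := @cvg_weights sigma setT (obox a b) _ phi measurableT mab (@subsetT _ _) (mbeta i)
  (aeW _ (fun x => beta1 x i)) mphi phi01 cphi.
under eq_fun => k.
  rewrite (@agree (phi k) i) //; last first.
    exists (cbox a b); split => //; [exact: compact_cbox|exact: phi0].
  over.
move=> lim1 lim2.
suff : (c (obox a b) = 0)%E by [].
rewrite cE; have : \int[sigma]_(x in obox a b) (beta x 0 i) =
    \int[m]_(x in obox a b) (nu x 0 i).
  exact: (cvg_unique (@norm_hausdorff _ _) lim1 lim2).
rewrite /Rintegral => hR.
by rewrite -(fineK (intS _ mab)) hR fineK ?intM// subee ?intM.
Qed.

(** On a null set of [sigma] all the integrals of [nu] vanish, so [nu] itself
    vanishes [m]-almost everywhere there; but it has norm 1. *)
Lemma vector_measures_dominate : m `<< sigma.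
Proof.
apply/null_content_dominatesP => A mA sA0.
have mOm : measurable Omega by exact: open_measurable_rV.
pose B := A `&` Omega.
have mB : measurable B by exact: measurableI.
suff : m B = 0%E.
  move=> mB0; apply/eqP; rewrite -measure_le0.
  apply: (@le_trans _ _ (m (B `|` ~` Omega))).
    apply: le_measure; rewrite ?inE//.
      by apply: measurableU => //; exact: measurableC.
    by move=> x Ax; have [Ox|nOx] := pselect (Omega x); [left|right].
  apply: (le_trans (measureU2 _ mB (measurableC mOm))).
  by rewrite [X in (X + _)%E]mB0 [X in (_ + X)%E]mO adde0.
have nu0 i : ae_eq m B (fun x => (nu x 0 i)%:E) (cst 0%E).
  apply: integral_ae_eq => //; first exact: integrableS (intnu i).
  move=> A' A'B mA'; rewrite integral0 -vector_measures_agree//; last first.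
    by move=> x /A'B[].
  apply: null_set_integral => //.
  - by apply/measurable_EFinP; exact: measurable_funTS.
  - by apply: (subset_measure0 mA' mA) => // x /A'B[].
suff [N [mN N0 BN]] : {ae m, forall x, ~ B x}.
  apply/eqP; rewrite -measure_le0 -N0; apply: le_measure; rewrite ?inE// => x Bx.
  by apply: BN => /=; exact.
have nu0' : {ae m, forall x i, B x -> nu x 0 i = 0}.
  apply: (@filter_forall _ _ (fun i x => B x -> nu x 0 i = 0) (almost_everywhere m)) => i.
  by apply: filterS (nu0 i) => x h /h [].
apply: filterS2 nu1 nu0' => x n1 n0 Bx; move: n1.
rewrite (_ : nu x = 0) ?enorm0; first by move=> /eqP; rewrite eq_sym oner_eq0.
by apply/rowP => i; rewrite n0// mxE.
Qed.

(** [h] is the Radon-Nikodym density of [m]: both [beta] and [h nu] are then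
    densities of the same vector measure on [Omega]. *)
Lemma vector_measures_polar : exists h : E -> R,
  [/\ measurable_fun setT h, forall x, 0 <= h x,
      forall B, measurable B -> (m B = \int[sigma]_(x in B) (h x)%:E)%E &
      {ae sigma, forall x, Omega x -> beta x = h x *: nu x}].
Proof.
have dom := vector_measures_dominate.
have mOm : measurable Omega by exact: open_measurable_rV.
pose f := Radon_Nikodym_SigmaFinite.f m sigma.
have ff x : f x \is a fin_num by exact: Radon_Nikodym_SigmaFinite.f_fin_num.
have intf : sigma.-integrable setT f by exact: Radon_Nikodym_SigmaFinite.f_integrable.
have mf := measurable_int _ intf.
exists (fine \o f); split.
- exact: measurableT_comp (fine_measurable _) mf.
- by move=> x; apply: fine_ge0; exact: Radon_Nikodym_SigmaFinite.f_ge0.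
- move=> B mB; under eq_integral do rewrite fineK//.
  exact: Radon_Nikodym_SigmaFinite.f_integral.
have rn := ae_eq_Radon_Nikodym_SigmaFinite dom measurableT.
have coord : {ae sigma, forall x i, Omega x -> (beta x 0 i)%:E = ((nu x 0 i)%:E *
    Radon_Nikodym (charge_of_finite_measure m) sigma x)%E}.
  apply: (@filter_forall _ _ (fun i x => Omega x -> (beta x 0 i)%:E = ((nu x 0 i)%:E *
    Radon_Nikodym (charge_of_finite_measure m) sigma x)%E) (almost_everywhere sigma)) => i.
  apply: integral_ae_eq => //.
  - exact: integrableS (intbeta i).
  - apply: emeasurable_funM; first by apply/measurable_EFinP; exact: measurable_funTS.
    exact: measurable_funTS.
  - move=> B BO mB; rewrite vector_measures_agree//.
    rewrite Radon_Nikodym_change_of_variables//.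
    exact: integrableS (intnu i).
apply: filterS2 rn coord => x /(_ Logic.I) fE bE Ox.
apply/rowP => i; rewrite mxE; apply: EFin_inj.
by rewrite bE// -fE EFinM /= fineK// muleC.
Qed.

End vector_measures.

(** * The reduced boundary *)

Section reduced_boundary.
Context {R : realType} {d : nat}.
Local Notation E := 'rV[R]_d.
Variable Omega : set E.

(** The distributional gradient only sees the values in [Omega]; in this way
    the gradients of a function with values 0 and 1 and of the indicator of a
    set are literally the same object. *)
Lemma is_BVgrad_eq (f g : E -> R) : (forall x, Omega x -> f x = g x) ->
  is_BVgrad Omega f = is_BVgrad Omega g.
Proof.
move=> fg; apply/funext => D.
apply/propext; split=> -[D0 mD D1 ibp]; split => // phi Cphi; rewrite -ibp//.
  by apply: eq_Rintegral => x; rewrite inE => /fg ->.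
by apply: eq_Rintegral => x; rewrite inE => /fg ->.
Qed.

Lemma BVgrad_eq (f g : E -> R) : (forall x, Omega x -> f x = g x) ->
  BVgrad Omega f = BVgrad Omega g.
Proof. by move=> fg; rewrite /BVgrad (is_BVgrad_eq fg). Qed.

Lemma BV_eq (f g : E -> R) : (forall x, Omega x -> f x = g x) ->
  BV Omega g -> BV Omega f.
Proof.
move=> fg [[[k [mk gk]] gfin] exD]; split; last by rewrite (is_BVgrad_eq fg).
split; last by under eq_integral => x do [rewrite inE => /fg ->].
by exists k; split => //; apply: filterS gk => x h Ox; rewrite fg// h.
Qed.

Lemma BVgradP (f : E -> R) : BV Omega f -> is_BVgrad Omega f (BVgrad Omega f).
Proof.
move=> [_ ex]; rewrite /BVgrad /some_or; case: pselect => // h.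
exact: projT2 (cid h).
Qed.

Lemma normal_unique (A : set E) (x nu : E) : is_normal Omega A x nu ->
  normal Omega A x = nu.
Proof.
move=> nx; rewrite /normal /some_or; case: pselect => [h|[]]; last by exists nu.
have [_ _ lim1 _] := projT2 (cid h); have [_ _ lim2 _] := nx.
exact: (cvg_unique (@norm_hausdorff _ _) lim1 lim2).
Qed.

(** Points of the reduced boundary are those where the averages of the polar
    vector converge to a unit vector, so that differentiation of the total
    variation measure gives the result. *)
Lemma reduced_boundary_ae (A : set E) (f : E -> R) : BV Omega f ->
  (forall x, Omega x -> \1_A x = f x) ->
  {ae BVvar Omega f, forall x, Omega x -> is_normal Omega A x ((BVgrad Omega f).2 x)}.
Proof.
move=> BVf Af; have := BVgradP BVf; have := BVgrad_eq Af.
rewrite /is_normal /perimeter_avg /BVvar => ->.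
set D := BVgrad Omega f => -[D0 mD D1 _].
have mDi i : measurable_fun setT (fun x => D.2 x 0 i).
  exact: measurableT_comp (measurable_coord i) mD.
have D1i i : {ae D.1, forall x, `|D.2 x 0 i| <= 1}.
  by apply: filterS D1 => x <-; exact: coord_le_enorm.
have avg : {ae D.1, forall x i, (fine (D.1 (eball x r)))^-1 *
    \int[D.1]_(y in eball x r) D.2 y 0 i @[r --> 0^'+] --> D.2 x 0 i}.
  apply: (@filter_forall _ _ (fun i x => (fine (D.1 (eball x r)))^-1 *
    \int[D.1]_(y in eball x r) D.2 y 0 i @[r --> 0^'+] --> D.2 x 0 i)
    (almost_everywhere D.1)) => i.
  exact: lebesgue_besicovitch (mDi i) (D1i i).
apply: filterS3 D1 (ae_ball_pos D.1) avg => x n1 pos lim Ox; split => //.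
apply/cvg_ballP => e e0.
have : \forall r \near 0^'+, forall i, `|D.2 x 0 i - (fine (D.1 (eball x r)))^-1 *
    \int[D.1]_(y in eball x r) D.2 y 0 i| < e.
  apply: (@filter_forall _ _ (fun i r => `|D.2 x 0 i - (fine (D.1 (eball x r)))^-1 *
    \int[D.1]_(y in eball x r) D.2 y 0 i| < e) (0^'+)) => i.
  by move: (lim i) => /cvgrPdist_lt; apply.
apply: filterS => r h; split => // i j; rewrite ord1 -ball_normE /= !mxE.
exact: h.
Qed.

End reduced_boundary.

(** * Compatible varifolds *)

Section compatible_varifold.
Context {R : realType} {d : nat}.
Local Notation E := 'rV[R]_d.

Lemma scaled_basis_field (Omega : set E) (phi : E -> R) i : Ck 1 phi ->
  supported_in Omega phi ->
  let eta x := phi x *: basis_vec i in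
  [/\ CkV 1 eta, forall x, ~ Omega x -> eta x = 0 & forall x s, dot (eta x) s = phi x * s 0 i].
Proof.
move=> Cphi [K [_ KO K0]] eta; split.
- move=> j.
  rewrite (_ : component j eta = fun x => phi x * (basis_vec i : E) 0 j).
    by apply: Ck1M => //; exact: Ck1_cst.
  by apply/funext => x; rewrite /component mxE.
- by move=> x nOx; rewrite /eta K0 ?scale0r// => /KO.
- move=> x s; rewrite dotZl; congr (_ * _).
  rewrite /dot (bigD1 i)//= mxE !eqxx mul1r big1 ?addr0// => j ji.
  by rewrite mxE eqxx (negbTE ji) mul0r.
Qed.

Variables (Omega : set E) (A : set E) (f : E -> R)
  (V : {measure set (E * E)%type -> \bar R}) (om : E -> {measure set E -> \bar R}).
Hypotheses (oO : open Omega) (Af : forall x, Omega x -> \1_A x = f x)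
  (BVf : BV Omega f) (oV : oriented_varifold (closure Omega) V)
  (Vom : disintegrates V (mass V) om)
  (omS : {ae mass V, forall x, probability_on_sphere (om x)})
  (compat : forall eta, CkV 1 eta ->
     (forall x, bdry Omega x -> dot (eta x) (inner_normal Omega x) = 0) ->
     \int[V]_(p in closure Omega `*` sphere) dot (eta p.1) p.2 = BVint Omega f eta).

(** The compatibility condition for the fields [phi e_i] is the hypothesis of
    [vector_measures_polar], for a representative of the barycenters. *)
Lemma compatible_density : exists h : E -> R,
  [/\ measurable_fun setT h, forall x, 0 <= h x,
      forall B, measurable B -> (BVvar Omega f B = \int[mass V]_(x in B) (h x)%:E)%E &
      {ae mass V, forall x, Omega x -> barycenter (om x) = h x *: (BVgrad Omega f).2 x}].
Proof.
have [Vfin VC] := oV.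
have mcl : measurable (closure Omega).
  rewrite -[closure Omega]setCK; apply: measurableC; apply: open_measurable_rV.
  by apply: closed_openC; exact: closed_closure.
have [beta [mbeta beta1 bE Vb]] := barycenter_representative Vfin Vom omS mcl VC.
have fin : fin_num_fun (mass V).
  move=> B mB; rewrite ge0_fin_numE//; apply: le_lt_trans Vfin.
  apply: le_measure; rewrite ?inE//; apply: measurableX => //.
  exact: measurable_sphere.
pose sigma : {finite_measure set E -> \bar R} :=
  HB.pack_for (FiniteMeasure.type E R) (mass V) (Measure_isFinite.Build _ _ _ (mass V) fin).
have [D0 mD D1 _] := BVgradP BVf; set D := BVgrad Omega f in D0 mD D1 *.
have mDi i : measurable_fun setT (fun x => D.2 x 0 i).
  exact: measurableT_comp (measurable_coord i) mD.
have [|h [mh h0 mE hE]] := @vector_measures_polar R d Omega sigma D.1 beta D.2 oO D0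
    mbeta beta1 mDi D1.
  move=> phi i Cphi sphi phi01.
  have := scaled_basis_field i Cphi sphi; set eta := fun x => _ => -[Ceta eta0 etaE].
  have mphi : measurable_fun setT phi.
    by apply: continuous_measurable_rV; have [] := Cphi.
  transitivity (\int[V]_(p in closure Omega `*` sphere) dot (eta p.1) p.2).
    rewrite -[LHS](Vb phi i mphi phi01); apply: eq_Rintegral => p _.
    exact/esym/etaE.
  rewrite compat//; last first.
    by move=> x [_ nOx]; rewrite eta0// /dot big1// => j _; rewrite mxE mul0r.
  by apply: eq_Rintegral => x _; exact: etaE.
exists h; split => //.
by apply: filterS2 bE hE => x -> h' /h'.
Qed.

(** Where [h] does not vanish, properties that hold almost everywhere for the
    total variation measure can be used almost everywhere for the mass. *)
Lemma compatible_barycenters : exists h : E -> R,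
  [/\ measurable_fun setT h, forall x, 0 <= h x,
      forall B, measurable B -> (BVvar Omega f B = \int[mass V]_(x in B) (h x)%:E)%E &
      {ae mass V, forall x, Omega x -> [/\ h x <= 1, enorm (barycenter (om x)) = h x,
        h x = 0 -> barycenter (om x) = 0 &
        h x <> 0 -> is_normal Omega A x (normal Omega A x) /\
          barycenter (om x) = h x *: normal Omega A x]}].
Proof.
have [h [mh h0 mE hE]] := compatible_density; exists h; split => //.
have hn := ae_density mh h0 mE (reduced_boundary_ae BVf Af).
apply: filterS3 omS hE hn => x Px bE hx Ox; have {}bE := bE Ox.
have b1 := enorm_barycenter_le1 Px.
case: hx => [hx0|/(_ Ox) nx].
  by rewrite bE hx0 scale0r enorm0; split => //; rewrite hx0.
have nE := normal_unique nx; have [_ _ _ n1] := nx.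
have bh : enorm (barycenter (om x)) = h x by rewrite bE enorm_Z// n1 mulr1.
split => //; first by rewrite -bh.
  by move=> hx0; rewrite bE hx0 scale0r.
by move=> _; rewrite nE.
Qed.

Lemma barycenter_on_reduced_boundary : {ae mass V, forall x, reduced_boundary Omega A x ->
  barycenter (om x) = enorm (barycenter (om x)) *: normal Omega A x}.
Proof.
have [h [_ _ _]] := compatible_barycenters; apply: filterS => x + rx.
have Ox : Omega x by case: rx => nu [].
move=> /(_ Ox)[_ bh bh0 bhn]; rewrite bh.
have [hx0|/eqP hx0] := eqVneq (h x) 0; first by rewrite bh0// hx0 scale0r.
by have [_ ->] := bhn hx0.
Qed.

Lemma barycenter_off_reduced_boundary : {ae mass V, forall x, Omega x ->
  ~ reduced_boundary Omega A x -> barycenter (om x) = 0}.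
Proof.
have [h [_ _ _]] := compatible_barycenters; apply: filterS => x + Ox nrx.
move=> /(_ Ox)[_ _ bh0 bhn].
have [|/eqP hx0] := eqVneq (h x) 0; first exact: bh0.
by have [nx _] := bhn hx0; exfalso; apply: nrx; exists (normal Omega A x).
Qed.

(** Equal total masses force [h = 1], that is, unit barycenters. *)
Lemma full_mass_dirac : mass V Omega = BVvar Omega f Omega ->
  {ae mass V, forall x, Omega x -> forall B, measurable B ->
    om x B = \d_(normal Omega A x) B}.
Proof.
move=> VO; have [h [mh h0 mE hx]] := compatible_barycenters.
have mO : measurable Omega by exact: open_measurable_rV.
have mOfin : BVvar Omega f Omega \is a fin_num by exact: fin_num_measure.
have mhO : measurable_fun Omega h by exact: measurable_funTS.
have inth : (mass V).-integrable Omega (EFin \o h).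
  apply/integrableP; split; first exact/measurable_EFinP.
  under eq_integral do rewrite gee0_abs ?lee_fin//.
  by rewrite -mE// ltey_eq mOfin.
have int1 : (mass V).-integrable Omega (EFin \o cst 1).
  apply: (@integrable_ae_bounded _ _ _ _ _ _ 1) => //.
    by rewrite [X in (X < _)%E]VO ltey_eq mOfin.
  by apply: aeW => x _; rewrite normr1.
have m1h : measurable_fun Omega (fun x => (1 - h x)%:E).
  by apply/measurable_EFinP; exact: measurable_funB.
have /(ae_eq_integral_abs _ mO m1h) : (\int[mass V]_(x in Omega) `|(1 - h x)%:E| = 0)%E.
  transitivity (\int[mass V]_(x in Omega) (1 - h x)%:E)%E.
    apply: ae_eq_integral => //; first exact: measurableT_comp.
    by apply: filterS hx => x + Ox => /(_ Ox)[h1 _ _ _]; rewrite gee0_abs// lee_fin subr_ge0.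
  rewrite [LHS](integralB mO int1 inth) -mE//.
  rewrite [X in (X - _)%E](_ : _ = BVvar Omega f Omega) ?subee//.
  by rewrite -VO -[RHS]mul1e; exact: (integral_cst (mass V) mO 1%E).
apply: filterS3 omS hx => x Px hx h1 Ox B mB.
have {h1} /eqP : 1 - h x = 0 by have [] := h1 Ox.
rewrite subr_eq0 => /eqP h1; have [_ bh _ bhn] := hx Ox.
have [|_ bE] := bhn; first by rewrite -h1; apply/eqP; exact: oner_neq0.
rewrite -h1 scale1r in bE.
by rewrite -bE; apply: unit_barycenter_dirac => //; rewrite bh.
Qed.

End compatible_varifold.

(** * The varifold of a solution *)

Unset Implicit Arguments.

Theorem corollary1p3 (R : realType) (d : nat) (hd : d = 2%N \/ d = 3%N)
  (Omega : set 'rV[R]_d) (hOmega : smooth_domain Omega)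
  (T c0 alpha : R) (hT : 0 < T) (hc0 : 0 < c0)
  (halpha : 0 < alpha <= pi / 2)
  (e : elastic_data) (he : elastic_ok e)
  (chi0 : 'rV[R]_d -> R) (u0 : 'rV[R]_d -> 'rV[R]_d)
  (hinit : initial_ok Omega chi0 u0)
  (s : candidate)
  (hs : varifold_solution Omega T c0 alpha e chi0 u0 s) :
  let A (t : R) : set 'rV[R]_d := [set x | Omega x /\ chi s t x = 1] in
  exists theta : R -> 'rV[R]_d -> R,
    (forall t x, 0 < t < T -> Omega x -> 0 <= theta t x) /\
    {ae (@lebesgue_measure R), forall t, 0 < t < T ->
      [/\ finite_perimeter Omega (A t),
          {ae mass (muO s t), forall x, Omega x -> `|theta t x| <= 1},
          {ae mass (muO s t), forall x, reduced_boundary Omega (A t) x ->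
            barycenter (muO_dis s t x) =
            theta t x *: normal Omega (A t) x},
          {ae mass (muO s t), forall x,
            Omega x -> ~ reduced_boundary Omega (A t) x ->
            barycenter (muO_dis s t x) = 0} &
          mass (muO s t) Omega = BVvar Omega (chi s t) Omega ->
          {ae mass (muO s t), forall x, Omega x ->
            forall B, measurable B ->
              muO_dis s t x B = \d_(normal Omega (A t) x) B}]}.
Proof.
move=> A; exists (fun t x => enorm (barycenter (muO_dis s t x))).
split=> [t x _ _|]; first exact: enorm_ge0.
have [oO _ _ _ _] := hOmega.
have [[M BVchi] _ _ _] := vs_chi_regular hs.
have [g [_ _ struct]] := vs_structure hs.
have aeF : Filter (almost_everywhere (@lebesgue_measure R)).
  exact: ae_filter_ringOfSetsType.
apply: filterS3 BVchi struct (vs_compatibility hs) => t BVt strt compt t0T.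
have It : `]0, T[%classic t by rewrite /= in_itv/= t0T.
have [[BVf _] _] := BVt It.
have [_ [oV _] [Vom omS] _ _] := strt It.
have [compat _ _] := compt It.
have Achi x : Omega x -> \1_(A t) x = chi s t x.
  move=> Ox; rewrite indicE; case: (vs_chi_01 hs It Ox) => chix; last first.
    by rewrite mem_set//; rewrite chix.
  rewrite memNset ?chix// => -[_]; rewrite chix => /eqP.
  by rewrite eq_sym oner_eq0.
split.
- exact: BV_eq Achi BVf.
- by apply: filterS omS => x Px _; rewrite ger0_norm ?enorm_ge0// enorm_barycenter_le1.
- exact: barycenter_on_reduced_boundary oO Achi BVf oV Vom omS compat.
- exact: barycenter_off_reduced_boundary oO Achi BVf oV Vom omS compat.
- exact: full_mass_dirac oO Achi BVf oV Vom omS compat.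
Qed.
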